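(* For every odd prime $p$, the Laurent series $\Theta_p(t)$ associated to the $p$-Cantor sequence exhibits full generic escape of mass with respect to the sequence $\{t^k\}_{k\ge0}$; that is, for every $\varepsilon>0$, $\lim_{n\to\infty}d(\{k\in\mathbb{N}:e_{k,n}(\Theta_p(t))>1-\varepsilon\})=1$.
   Context: The $p$-Cantor sequence: for an odd prime $p$, $p_2=\frac{p-1}{2}$, identify $\{0,\dots,p-1\}$ with $\mathbb{F}_p$ and let $\phi_p(n)$ be the word of length $p$ whose $i$-th letter ($0\le i\le p-1$) is $n\binom{p_2}{i/2}\bmod p$ for even $i$ and $0$ for odd $i$; $\phi_p$ acts on words by concatenation. $(c^{(p)}_i)_{i\ge0}=\lim_n\phi_p^n(1)$ and $\Theta_p(t)=t^{-1}\sum_{i\ge0}c^{(p)}_it^{-i}$. For a quadratic irrational $\Theta$, $e_{k,n}(\Theta):=\frac{\sum_{i=1}^{\ell_{k}}\max\{\deg A_i^{[\Theta t^k]}-n,0\}}{\sum_{i=1}^{\ell_{k}}\deg A_i^{[\Theta t^k]}}$, where $\ell_k$ is the period length of the eventually periodic continued fraction expansion of $\Theta\cdot t^k$ and $A_1^{[\Theta t^k]},\dots,A_{\ell_k}^{[\Theta t^k]}$ are the partial quotients of one period. For $A\subseteq\mathbb{N}$, $d(A)=\lim_{m\to\infty}\frac{|A\cap\{1,\dots,m\}|}{m}$. *)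

(* Defs.v *)
From Stdlib Require Import Reals ClassicalDescription.
From HB Require Import structures.
From mathcomp Require Import all_boot all_order all_algebra.
Set Implicit Arguments. Unset Strict Implicit. Unset Printing Implicit Defensive.
Import GRing.Theory Num.Theory.

Section Laurent.
Variable F : fieldType.
Local Open Scope ring_scope.

(* Laurent b c represents  sum_{i >= 0} c i * t^(b - i). *)
Record laurent := Laurent { lbound : int; lcoef : nat -> F }.

Definition coefL (x : laurent) (m : int) : F :=
  if m <= lbound x then lcoef x (absz (lbound x - m)) else 0.

Definition eqL (x y : laurent) : Prop := forall m, coefL x m = coefL y m.

Definition addL (x y : laurent) : laurent :=
  let M := Num.max (lbound x) (lbound y) in
  Laurent M (fun n => coefL x (M - n%:Z) + coefL y (M - n%:Z)).

Definition oppL (x : laurent) : laurent :=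
  Laurent (lbound x) (fun n => - lcoef x n).

Definition mulL (x y : laurent) : laurent :=
  Laurent (lbound x + lbound y)
    (fun n => \sum_(i < n.+1) lcoef x i * lcoef y (n - i)%N).

Definition oneL : laurent := Laurent 0 (fun n => if n == 0%N then 1 else 0).

Definition polyL (q : {poly F}) : laurent :=
  Laurent (size q)%:Z (fun n => if (n <= size q)%N then q`_(size q - n) else 0).

Definition polypart (x : laurent) : {poly F} :=
  \poly_(i < (absz (lbound x)).+1) coefL x i%:Z.

Definition cf_expansion (x : laurent) (A : nat -> {poly F}) : Prop :=
  exists xs : nat -> laurent,
    eqL (xs 0%N) x /\
    forall i, A i = polypart (xs i) /\
              eqL (mulL (addL (xs i) (oppL (polyL (A i)))) (xs i.+1)) oneL.

End Laurent.

Definition degP (F : fieldType) (q : {poly F}) : nat := (size q).-1.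

Definition is_period (T : Type) (A : nat -> T) (N l : nat) : Prop :=
  (0 < l)%N /\ forall i, (N <= i)%N -> A (i + l)%N = A i.

Definition period_length (T : Type) (A : nat -> T) (l : nat) : Prop :=
  (exists N, is_period A N l) /\ forall N' l', is_period A N' l' -> (l <= l')%N.

(* ratio  sum max(deg A_i - n, 0) / sum deg A_i  over the period A_N..A_{N+l-1}
   (nat subtraction is truncated, so (d - n)%N = max(d - n, 0)). *)
Definition escape_ratio (F : fieldType) (A : nat -> {poly F}) (N l n : nat) : R :=
  Rdiv (INR (\sum_(N <= i < N + l) (degP (A i) - n)))
       (INR (\sum_(N <= i < N + l) degP (A i))).

Definition e_val (F : fieldType) (x : laurent F) (n : nat) (r : R) : Prop :=
  exists (A : nat -> {poly F}) (N l : nat),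
    cf_expansion x A /\ period_length A l /\ is_period A N l /\
    r = escape_ratio A N l n.

Section Cantor.
Variable p : nat.
Local Open Scope ring_scope.

Definition p2 : nat := (p.-1)./2.

Definition phi_letter (n : 'F_p) (i : nat) : 'F_p :=
  if odd i then 0 else n * ('C(p2, i./2))%:R.

Definition phi_word (n : 'F_p) : seq 'F_p := mkseq (phi_letter n) p.

Definition phi (w : seq 'F_p) : seq 'F_p := flatten (map phi_word w).

(* c_i = i-th letter of lim_n phi^n(1); phi^(i+1)(1) has length p^(i+1) > i
   and is a prefix of all later iterates. *)
Definition cantor (i : nat) : 'F_p := nth 0 (iter i.+1 phi [:: 1]) i.

Definition Theta : laurent 'F_p := Laurent (-1) cantor.

End Cantor.

Definition count_upto (P : nat -> Prop) (m : nat) : nat :=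
  \sum_(1 <= k < m.+1) (if excluded_middle_informative (P k) then 1 else 0)%N.

Definition has_density (P : nat -> Prop) (d : R) : Prop :=
  Un_cv (fun m => Rdiv (INR (count_upto P m)) (INR m)) d.

(* Main.v *)
Require Import Defs.
From Stdlib Require Import Reals ClassicalDescription Lra.
From HB Require Import structures.
From mathcomp Require Import all_boot all_order all_algebra.
From mathcomp Require Import boolp finfield.
From mathcomp Require Import ring zify.
Set Implicit Arguments. Unset Strict Implicit. Unset Printing Implicit Defensive.
Import Order.TTheory GRing.Theory Num.Theory.

(** Since [c_(pn+i) = c_n a_i] with [sum_i a_i x^i = (1 + x^2)^((p-1)/2)], the
    series [theta = Theta_p] satisfies [theta^2 (t^2 + 1) = 1].  Hence
    [t^k theta] is quadratic over [F_p(t)], with a periodic continued fraction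
    because the complete quotients [(P + s) / Q] take finitely many values.

    As [theta] is odd in [t], for [a] odd and [d] even there is a polynomial
    [Q] of degree at most [d] approximating [t^a theta] to order [d + 2].
    Raising this to the power [q = p^s] and multiplying by a power of [t] gives
    good approximations of [t^k theta] for all [k] near [a q], so certain
    windows of degrees contain no degree of a convergent denominator of
    [t^k theta].  These windows are periodic in [(k, m)] modulo [2q], and each
    class of [(k, m)] modulo [2 p^s] meets the windows of scale [p^(s+1)].
    A proportion at most [(1 - 1/p^2)^S] of the pairs therefore survives [S]
    scales.  So for most [k] the average partial quotient over a period is
    large, and truncating by [n] loses a small share of the total degree: the
    density is already 1 for every fixed [n]. *)

(** * Formal power series *)

Definition fps (F : fieldType) : Type := nat -> F.

Section PowerSeries.
Local Open Scope ring_scope.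
Variable F : fieldType.
Implicit Types a b c : fps F.

HB.instance Definition _ := Choice.copy (fps F) (nat -> F).

Definition fps_const (z : F) : fps F := fun n => if n == 0%N then z else 0.
Definition fps_add a b : fps F := fun n => a n + b n.
Definition fps_opp a : fps F := fun n => - a n.
Definition fps_mul a b : fps F := fun n => \sum_(i < n.+1) a i * b (n - i)%N.

(** A coefficient of a product depends only on truncations of the factors, so commutativity and
    associativity are inherited from [{poly F}]. *)
Definition fps_trunc (N : nat) a : {poly F} := \poly_(i < N) a i.

Lemma fps_mul_trunc N a b n : (n < N)%N ->
  fps_mul a b n = (fps_trunc N a * fps_trunc N b)`_n.
Proof.
move=> nN; rewrite coefM /fps_mul; apply: eq_bigr => i _.
by rewrite !coef_poly !(leq_ltn_trans _ nN) ?leq_subr // -ltnS.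
Qed.

Lemma fps_addA : associative fps_add.
Proof. by move=> a b c; apply: funext => n; rewrite /fps_add addrA. Qed.
Lemma fps_addC : commutative fps_add.
Proof. by move=> a b; apply: funext => n; rewrite /fps_add addrC. Qed.
Lemma fps_add0 : left_id (fun=> 0) fps_add.
Proof. by move=> a; apply: funext => n; rewrite /fps_add add0r. Qed.
Lemma fps_addN : left_inverse (fun=> 0) fps_opp fps_add.
Proof. by move=> a; apply: funext => n; rewrite /fps_add /fps_opp addNr. Qed.

HB.instance Definition _ :=
  GRing.isZmodule.Build (fps F) fps_addA fps_addC fps_add0 fps_addN.

Lemma fps_mulC : commutative fps_mul.
Proof.
move=> a b; apply: funext => n.
by rewrite !(@fps_mul_trunc n.+1) // mulrC.
Qed.

Lemma fps_mulA : associative fps_mul.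
Proof.
have E a b c n : fps_mul (fps_mul a b) c n =
    (fps_trunc n.+1 a * fps_trunc n.+1 b * fps_trunc n.+1 c)`_n.
  rewrite coefM /fps_mul; apply: eq_bigr => i _.
  rewrite coef_poly ltnS leq_subr; congr (_ * _).
  exact: (@fps_mul_trunc n.+1).
move=> a b c; apply: funext => n.
by rewrite fps_mulC !E (mulrC (_ * _)) mulrA.
Qed.

Lemma fps_mul1 : left_id (fps_const 1) fps_mul.
Proof.
move=> a; apply: funext => n; rewrite /fps_mul big_ord_recl /= subn0 mul1r.
by rewrite big1 ?addr0 // => i _; rewrite mul0r.
Qed.

Lemma fps_mulDl : left_distributive fps_mul fps_add.
Proof.
move=> a b c; apply: funext => n; rewrite /fps_mul /fps_add -big_split /=.
by apply: eq_bigr => i _; rewrite mulrDl.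
Qed.

Lemma fps_oner_neq0 : fps_const 1 != 0 :> fps F.
Proof.
apply/eqP => /(congr1 (fun a : fps F => a 0%N)) /eqP; rewrite /fps_const /=.
by rewrite oner_eq0.
Qed.

HB.instance Definition _ := GRing.Zmodule_isComNzRing.Build (fps F)
  fps_mulA fps_mulC fps_mul1 fps_mulDl fps_oner_neq0.

Lemma fps_addE a b n : (a + b) n = a n + b n. Proof. by []. Qed.
Lemma fps_oppE a n : (- a) n = - a n. Proof. by []. Qed.
Lemma fps_mulE a b n : (a * b) n = \sum_(i < n.+1) a i * b (n - i)%N.
Proof. by []. Qed.
Lemma fps_sumE (I : Type) (r : seq I) (P : pred I) (f : I -> fps F) n :
  (\sum_(i <- r | P i) f i) n = \sum_(i <- r | P i) f i n.
Proof. by elim/big_rec2: _ => // i u v _ <-. Qed.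

Lemma fps_const_is_zmod_morphism : zmod_morphism fps_const.
Proof.
move=> u v; apply: funext => n; rewrite fps_addE fps_oppE /fps_const.
by case: eqP; rewrite ?subr0.
Qed.

Lemma fps_constM z a n : (fps_const z * a) n = z * a n.
Proof.
rewrite fps_mulE big_ord_recl /= subn0 big1 ?addr0 // => i _.
by rewrite /fps_const mul0r.
Qed.

Lemma fps_const_is_monoid_morphism : monoid_morphism fps_const.
Proof.
split=> // u v; apply: funext => n; rewrite fps_constM /fps_const.
by case: eqP; rewrite ?mulr0.
Qed.

HB.instance Definition _ :=
  GRing.isZmodMorphism.Build F (fps F) fps_const fps_const_is_zmod_morphism.
HB.instance Definition _ :=
  GRing.isMonoidMorphism.Build F (fps F) fps_const fps_const_is_monoid_morphism.

Definition fps_X : fps F := fun n => if n == 1%N then 1 else 0.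

Lemma fps_XM a n : (fps_X * a) n = if n is m.+1 then a m else 0.
Proof.
rewrite fps_mulE; case: n => [|m]; first by rewrite big_ord1 mul0r.
rewrite 2!big_ord_recl /= mul0r add0r mul1r subSS subn0 big1 ?addr0 // => i _.
by rewrite mul0r.
Qed.

Lemma fps_XnM j a n : (fps_X ^+ j * a) n = if (j <= n)%N then a (n - j)%N else 0.
Proof.
elim: j n => [|j IH] [|n]; rewrite ?expr0 ?mul1r ?subn0 //.
  by rewrite exprS -mulrA fps_XM.
by rewrite exprS -mulrA fps_XM IH.
Qed.

Lemma fps_Xn j n : (fps_X ^+ j : fps F) n = (j == n)%:R.
Proof.
rewrite -[_ ^+ j]mulr1 fps_XnM /=; case: ltngtP => [jn|//|->].
  by rewrite /GRing.one /= /fps_const; case: (n - j)%N (subn_gt0 j n) => //=; rewrite jn.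
by rewrite subnn.
Qed.

Lemma fps_decomp a :
  a = fps_const (a 0%N) + fps_X * (fun n => a n.+1 : F).
Proof.
by apply: funext => -[|n]; rewrite fps_addE fps_XM /fps_const /= ?addr0 ?add0r.
Qed.

Lemma fps_shift j a :
  (forall n, (n < j)%N -> a n = 0) -> a = fps_X ^+ j * (fun n => a (n + j)%N).
Proof.
move=> a0; apply: funext => n; rewrite fps_XnM.
by case: leqP => [jn|/a0 //]; rewrite subnK.
Qed.

Lemma fps_order a : a != 0 ->
  exists j b, a = fps_X ^+ j * b /\ b 0%N != 0.
Proof.
move=> a0; have ex : exists n, a n != 0.
  apply: contrapT => /forallNP H; case/eqP: a0; apply: funext => n.
  by apply/eqP/negPn/negP/H.
exists (ex_minn ex), (fun n => a (n + ex_minn ex)%N).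
case: ex_minnP => m am min_m; rewrite add0n; split=> //.
by apply: fps_shift => n; apply: contraTeq => /min_m; rewrite -leqNgt.
Qed.

Definition fps_geom a : fps F := fun n => \sum_(i < n.+1) (a ^+ i) n.

(* 1 / (1 - X a) is the geometric series, and (X a)^i only has terms of
   degree at least i. *)
Lemma fps_geomP a : (1 - fps_X * a) * fps_geom (fps_X * a) = 1.
Proof.
apply: funext => n; set v := fps_X * a.
have vi i m : (m < i)%N -> (v ^+ i) m = 0.
  by move=> mi; rewrite /v exprMn fps_XnM leqNgt mi.
have E : ((1 - v) * fps_geom v) n = ((1 - v) * \sum_(i < n.+1) v ^+ i) n.
  rewrite !fps_mulE; apply: eq_bigr => j _; congr (_ * _).
  rewrite fps_sumE /fps_geom (big_ord_widen n.+1 (fun i => (v ^+ i) (n - j)%N)) ?ltnS ?leq_subr //.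
  rewrite [RHS](bigID (fun i : 'I_n.+1 => (i < (n - j).+1)%N)) /=.
  rewrite [X in _ + X]big1 ?addr0 // => i; rewrite -leqNgt; exact: vi.
rewrite E -opprB mulNr -subrX1 opprB fps_addE fps_oppE vi // subr0 //.
Qed.

Definition fps_unit : pred (fps F) := fun a => a 0%N != 0.
(** Writing [a = a_0 (1 - X v)] reduces inversion to the geometric series in [X v]; non-units are
    fixed, as the unit ring structure requires. *)
Definition fps_inv a : fps F :=
  if fps_unit a then
    let u : fps F := fps_const (a 0%N)^-1 in
    u * fps_geom (fps_X * - (u * (fun n => a n.+1 : F)))
  else a.

Lemma fps_mulV : {in fps_unit, left_inverse 1 fps_inv *%R}.
Proof.
move=> a ua; have a0 : a 0%N != 0 by [].
rewrite /fps_inv /fps_unit a0.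
set u := fps_const _; set b := fun n => _.
have -> : a = fps_const (a 0%N) * (1 - fps_X * - (u * b)).
  rewrite {1}(fps_decomp a) mulrN opprK mulrDr mulr1; congr (_ + _).
  by rewrite mulrCA [fps_const _ * _]mulrA -rmorphM divff // rmorph1 mul1r.
rewrite mulrACA -rmorphM mulVf // rmorph1 mul1r mulrC; exact: fps_geomP.
Qed.

Lemma fps_unitP a b : b * a = 1 -> a \in fps_unit.
Proof.
move=> /(congr1 (fun a : fps F => a 0%N)); rewrite fps_mulE big_ord1 => ba.
rewrite unfold_in /fps_unit; apply: contra_eq_neq ba => ->.
by rewrite mulr0 eq_sym; exact: oner_neq0.
Qed.

Lemma fps_invr_out : {in [predC fps_unit], fps_inv =1 id}.
Proof.
by move=> a ua; have /negbTE ua' : ~~ fps_unit a by []; rewrite /fps_inv ua'.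
Qed.

HB.instance Definition _ := GRing.ComNzRing_hasMulInverse.Build (fps F)
  fps_mulV fps_unitP fps_invr_out.

Lemma fps_idomain a b : a * b = 0 -> (a == 0) || (b == 0).
Proof.
apply: contra_eqT; rewrite negb_or => /andP[/fps_order[i [u [-> u0]]]].
move=> /fps_order[j [v [-> v0]]]; rewrite mulrACA -exprD.
apply/eqP => /(congr1 (fun a : fps F => a (i + j)%N)).
rewrite fps_XnM leqnn subnn fps_mulE big_ord1 => /eqP.
by rewrite mulf_eq0 (negbTE u0) (negbTE v0).
Qed.

HB.instance Definition _ := GRing.ComUnitRing_isIntegral.Build (fps F) fps_idomain.

Lemma fps_unitE a : (a \is a GRing.unit) = (a 0%N != 0).
Proof. by []. Qed.

End PowerSeries.

Section LaurentField.
Local Open Scope ring_scope.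

(** * Laurent series in [1/t] *)

Lemma frac_numden (R : idomainType) (z : {fraction R}) :
  exists n d : R, d != 0 /\ z = tofrac n / tofrac d.
Proof.
elim/quotW: z => x; exists \n_x, \d_x; split; first exact: denom_ratioP.
apply/(canRL (mulfK _)); first by rewrite tofrac_eq0 denom_ratioP.
unlock tofrac; rewrite -[LHS]FracField.pi_mul; apply/eqmodP.
rewrite /= FracField.equivfE /FracField.mulf.
rewrite !numden_Ratio ?mulf_neq0 ?oner_neq0 ?denom_ratioP //.
by rewrite !mulr1 mulrC.
Qed.

Variable F : fieldType.
Local Notation K := {fraction (fps F)}.
Implicit Types (X Y : laurent F) (a b : fps F) (x y z : K) (q : {poly F}) (n m : int).

(* [tvar] is the paper's [t], the inverse of the power series variable. *)
Definition tvar : K := (tofrac (fps_X F))^-1.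
(** The inclusion of [F[t]] in the Laurent series: scalars become constant series and the variable
    becomes [tvar]. *)
Definition pemb : {poly F} -> K :=
  horner_eval tvar \o map_poly (@tofrac (fps F) \o @fps_const F).
HB.instance Definition _ := GRing.RMorphism.copy pemb
  (horner_eval tvar \o map_poly (@tofrac (fps F) \o @fps_const F)).

(** The degree in [t] is at most [n]. As a relation it needs no degree for 0; [degle (-1)] expresses
    a zero polynomial part. *)
Definition degle n z : Prop := exists a, z = tvar ^ n * tofrac a.

Lemma fps_X_neq0 : fps_X F != 0.
Proof.
apply/eqP => /(congr1 (fun a : fps F => a 1%N)) /eqP; rewrite /fps_X /=.
by rewrite oner_eq0.
Qed.

Lemma tvar_neq0 : tvar != 0.
Proof. by rewrite invr_eq0 tofrac_eq0 fps_X_neq0. Qed.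

Lemma tvarN (j : nat) : tvar ^ (- j%:Z) = tofrac (fps_X F ^+ j).
Proof. by rewrite -exprnN -exprVn invrK tofracXn. Qed.

Lemma tvarD n m : tvar ^ (n + m) = tvar ^ n * tvar ^ m.
Proof. by rewrite expfzDr ?tvar_neq0. Qed.

Lemma tvar_split (i u : nat) : (i <= u)%N ->
  tvar ^+ i = tvar ^ u%:Z * tofrac (fps_X F ^+ (u - i)).
Proof.
move=> iu; rewrite -tvarN -tvarD exprnP; congr (_ ^ _); lia.
Qed.

Lemma degle_le n m z : n <= m -> degle n z -> degle m z.
Proof.
move=> nm [a ->]; exists (fps_X F ^+ `|m - n|%N * a).
rewrite tofracM -tvarN mulrA -tvarD; congr (_ ^ _ * _); lia.
Qed.

Lemma degle0 n : degle n 0.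
Proof. by exists 0; rewrite tofrac0 mulr0. Qed.

Lemma degleD n x y : degle n x -> degle n y -> degle n (x + y).
Proof. by move=> [a ->] [b ->]; exists (a + b); rewrite tofracD mulrDr. Qed.

Lemma degleN n x : degle n x -> degle n (- x).
Proof. by move=> [a ->]; exists (- a); rewrite tofracN mulrN. Qed.

Lemma degleB n x y : degle n x -> degle n y -> degle n (x - y).
Proof. by move=> nx /degleN; apply: degleD. Qed.

Lemma degleM n m x y : degle n x -> degle m y -> degle (n + m) (x * y).
Proof.
by move=> [a ->] [b ->]; exists (a * b); rewrite tofracM tvarD mulrACA.
Qed.

Lemma degle_t n : degle n (tvar ^ n).
Proof. by exists 1; rewrite tofrac1 mulr1. Qed.

Lemma degle_fps a : degle 0 (tofrac a).
Proof. by exists a; rewrite mul1r. Qed.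

Lemma degleX n (j : nat) x : degle n x -> degle (n * j%:Z) (x ^+ j).
Proof.
move=> nx; elim: j => [|j IH].
  by rewrite mulr0 expr0; exact: (degle_t 0).
by rewrite exprS intS mulrDr mulr1; apply: degleM.
Qed.

(** Since [a_0] is nonzero the degree is exactly [m]: a smaller bound would make [a] a multiple of
    the series variable. *)
Lemma degle_top n m a : a 0%N != 0 -> degle n (tvar ^ m * tofrac a) -> m <= n.
Proof.
move=> a0 [b]; case: leP => // nm E; case/eqP: a0.
have : tofrac a = tofrac (fps_X F ^+ `|m - n|%N * b).
  rewrite tofracM -tvarN; apply: (mulfI (expfz_neq0 m tvar_neq0)).
  rewrite E mulrA -tvarD; congr (_ ^ _ * _); lia.
move/eqP; rewrite tofrac_eq => /eqP ->; rewrite fps_XnM.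
by have -> : (`|m - n| <= 0)%N = false by lia.
Qed.

Lemma pembX : pemb 'X = tvar.
Proof. by rewrite /pemb /= map_polyX /horner_eval hornerX. Qed.

Lemma pembXn (k : nat) : pemb 'X^k = tvar ^+ k.
Proof. by rewrite rmorphXn /= pembX. Qed.

Lemma pembC (c : F) : pemb c%:P = tofrac (fps_const c).
Proof. by rewrite /pemb /= map_polyC /horner_eval hornerC. Qed.

(** The right side is the value of [polyL q]. Its exponent is the size and not the degree, so the
    constant term of the series is 0. *)
Lemma pembE q : pemb q =
  tvar ^ (size q)%:Z *
    tofrac ((fun n : nat => if (n <= size q)%N then q`_(size q - n) else 0) : fps F).
Proof.
set a := (fun n : nat => _) : fps F.
have -> : a = \sum_(i < size q) fps_const q`_i * fps_X F ^+ (size q - i).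
  apply: funext => n; rewrite fps_sumE /a.
  have E i : (fps_const q`_i * fps_X F ^+ (size q - i)%N) n =
      if (size q - i == n)%N then q`_i else 0.
    by rewrite fps_constM fps_Xn; case: eqP; rewrite ?mulr1 ?mulr0.
  under eq_bigr do rewrite E.
  case: leqP => [nq|qn]; last first.
    by rewrite big1 // => i _; case: eqP => // H; move: qn; rewrite -H ltnNge leq_subr.
  rewrite -big_mkcond /=.
  case: (posnP n) => [->|n0].
    rewrite subn0 nth_default // big1 // => i /eqP H.
    by have := ltn_ord i; rewrite -subn_gt0 H.
  have lt : (size q - n < size q)%N by lia.
  rewrite (big_pred1 (Ordinal lt)) // => i; have := ltn_ord i.
  rewrite /= -val_eqE /= => iq; rewrite -(eqn_add2r i) subnK ?(ltnW iq) //.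
  by rewrite -[RHS](eqn_add2r n) subnK // addnC eq_sym.
rewrite (rmorph_sum (@tofrac (fps F))) mulr_sumr {1}/pemb /= /horner_eval.
rewrite (horner_coef_wide _ (size_poly _ _)); apply: eq_bigr => i _.
rewrite coef_map /= rmorphM mulrCA; congr (_ * _).
exact: tvar_split (ltnW (ltn_ord i)).
Qed.

(** Removing the zero constant term of the series in [pembE] lowers the exponent from the size to
    the degree. *)
Lemma pemb_top q : q != 0 -> exists a,
  pemb q = tvar ^ (size q).-1%:Z * tofrac a /\ a 0%N = lead_coef q.
Proof.
rewrite -size_poly_gt0 pembE => q0; set a := (fun n : nat => _) : fps F.
exists (fun n : nat => a n.+1); split; last by rewrite /a q0 subn1 -lead_coefE.
have {1}-> : a = fps_X F ^+ 1 * ((fun n : nat => a n.+1) : fps F).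
  apply: funext => n; rewrite fps_XnM /a; case: n => [|n] //=.
    by rewrite nth_default ?subn0.
  by rewrite subSS subn0.
rewrite tofracM -tvarN mulrA -tvarD; congr (_ ^ _ * _); lia.
Qed.

Lemma degle_pemb q : degle ((size q)%:Z - 1) (pemb q).
Proof.
have [->|/[dup] q0 /pemb_top[a [-> _]]] := eqVneq q 0.
  by rewrite rmorph0; exact: degle0.
exists a; congr (_ ^ _ * _); move: q0; rewrite -size_poly_gt0; lia.
Qed.

Lemma pemb_size q (N : nat) : degle (N%:Z - 1) (pemb q) -> (size q <= N)%N.
Proof.
have [->|/[dup] q0 /pemb_top[a [-> a0]]] := eqVneq q 0; first by rewrite size_poly0.
by move=> /degle_top; rewrite a0 lead_coef_eq0 => /(_ q0); lia.
Qed.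

Lemma pemb_inj : injective pemb.
Proof.
move=> q r E; apply/eqP; rewrite -subr_eq0 -size_poly_leq0.
by apply: pemb_size; rewrite rmorphB /= E subrr; exact: degle0.
Qed.

Lemma pemb_eq0 q : (pemb q == 0) = (q == 0).
Proof. by rewrite -(inj_eq pemb_inj) rmorph0. Qed.

Lemma degle_neg_pemb q : degle (-1) (pemb q) -> q = 0.
Proof. by move=> H; apply/eqP; rewrite -size_poly_leq0; exact: pemb_size. Qed.

(** The leading term of [A + y] is that of [A], so [A + y] is [t^d] times a unit power series, with
    [d] the degree of [A]. *)
Lemma degle_inv (A : {poly F}) y z : A != 0 -> degle (-1) y ->
  z * (pemb A + y) = 1 -> degle (- (size A).-1%:Z) z.
Proof.
move=> A0 [b ->]; have [a [-> a0]] := pemb_top A0.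
set d := (size A).-1; set c := a + fps_X F ^+ d.+1 * b.
have -> : tvar ^ d%:Z * tofrac a + tvar ^ (-1) * tofrac b = tvar ^ d%:Z * tofrac c.
  rewrite /c tofracD mulrDr; congr (_ + _); rewrite tofracM -tvarN mulrA -tvarD.
  congr (_ ^ _ * _); lia.
have c0 : c \is a GRing.unit.
  by rewrite fps_unitE /c fps_addE fps_XnM addr0 a0 lead_coef_eq0.
move=> zc; exists c^-1.
have cV : tofrac c * tofrac c^-1 = 1 by rewrite -tofracM divrr // tofrac1.
rewrite -[RHS]mul1r -zc -mulrA mulrACA -tvarD addrN expr0z cV.
by rewrite !mulr1.
Qed.

(** The record read as an element of the field, where the algebra is done; [eqL] amounts to equality
    of these values. *)
Definition laurent_val (X : laurent F) : K :=
  tvar ^ lbound X * tofrac (lcoef X : fps F).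

(** Any larger [M] can serve as bound, which puts two series over a common power of [t]. *)
Lemma laurent_val_bound M (X : laurent F) : lbound X <= M ->
  laurent_val X = tvar ^ M * tofrac ((fun n : nat => coefL X (M - n%:Z)) : fps F).
Proof.
case: X => b c /= bM; rewrite /laurent_val /=.
have -> : ((fun n : nat => coefL (Laurent b c) (M - n%:Z)) : fps F) =
    fps_X F ^+ `|M - b|%N * c.
  apply: funext => n; rewrite fps_XnM /coefL /=.
  have -> : (M - n%:Z <= b) = (`|M - b| <= n)%N by lia.
  by case: leqP => // H; congr (c _); lia.
rewrite tofracM -tvarN mulrA -tvarD; congr (_ ^ _ * _); lia.
Qed.

Lemma laurent_val_eqL (X Y : laurent F) : laurent_val X = laurent_val Y -> eqL X Y.
Proof.
set M := Num.max (lbound X) (lbound Y).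
have XM : lbound X <= M by rewrite le_max lexx.
have YM : lbound Y <= M by rewrite le_max lexx orbT.
rewrite (laurent_val_bound XM) (laurent_val_bound YM).
move=> /(mulfI (expfz_neq0 M tvar_neq0)) /eqP; rewrite tofrac_eq => /eqP E m.
case: (leP m M) => mM; last first.
  by rewrite /coefL !ifF //; lia.
have /(congr1 (fun a : fps F => a `|M - m|%N)) := E.
by have -> : M - `|M - m|%N%:Z = m by lia.
Qed.

Lemma laurent_val_add X Y :
  laurent_val (addL X Y) = laurent_val X + laurent_val Y.
Proof.
set M := Num.max (lbound X) (lbound Y).
have XM : lbound X <= M by rewrite le_max lexx.
have YM : lbound Y <= M by rewrite le_max lexx orbT.
by rewrite (laurent_val_bound XM) (laurent_val_bound YM) -mulrDr -tofracD.
Qed.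

Lemma laurent_val_opp X : laurent_val (oppL X) = - laurent_val X.
Proof. by rewrite /laurent_val -mulrN -tofracN. Qed.

Lemma laurent_val_mul X Y :
  laurent_val (mulL X Y) = laurent_val X * laurent_val Y.
Proof. by rewrite /laurent_val /= tvarD mulrACA -tofracM. Qed.

Lemma laurent_val_one : laurent_val (oneL F) = 1.
Proof. by rewrite /laurent_val /= mul1r tofrac1. Qed.

Lemma laurent_val_poly q : laurent_val (polyL q) = pemb q.
Proof. by rewrite pembE. Qed.

Lemma fps_unit_decomp a : a != 0 ->
  exists j b, b \is a GRing.unit /\ a = fps_X F ^+ j * b.
Proof. by move=> /fps_order[j [b [-> b0]]]; exists j, b. Qed.

(** A denominator is a power of the series variable times a unit, so every fraction is a power of
    [t] times a power series. *)
Lemma laurent_val_surj z : exists X, laurent_val X = z.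
Proof.
suff [n [c ->]] : exists n (c : fps F), z = tvar ^ n * tofrac c by exists (Laurent n c).
have [n [d [d0 ->]]] := frac_numden z.
have [j [b [ub ->]]] := fps_unit_decomp d0.
exists j%:Z, (n * b^-1).
rewrite [tofrac (_ ^+ j * b)]tofracM -tvarN invfM invr_expz opprK.
by rewrite tofracM mulrCA rmorphV.
Qed.

Lemma coefL_gt (X : laurent F) m : lbound X < m -> coefL X m = 0.
Proof. by move=> Xm; rewrite /coefL leNgt Xm. Qed.

Lemma coefL_add X Y m :
  coefL (addL X Y) m = coefL X m + coefL Y m.
Proof.
rewrite {1}/coefL /=; set M := Num.max _ _.
case: (leP m M) => [mM|]; last first.
  by rewrite gt_max => /andP[Xm Ym]; rewrite !coefL_gt ?addr0.
by have -> : M - `|M - m|%N%:Z = m by lia.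
Qed.

Lemma coefL_poly q m : coefL (polyL q) m = if m is Posz i then q`_i else 0.
Proof.
rewrite /coefL /=; move E : (size q) => N.
case: m => [i|i]; case: (leP _ N%:Z) => H //.
- by rewrite ifT; [congr (q`_ _); lia | lia].
- by rewrite nth_default // E; lia.
- by rewrite ifF //; lia.
Qed.

Lemma polypartE X q : (forall i : nat, coefL X i%:Z = q`_i) -> polypart X = q.
Proof.
move=> co; apply/polyP => i; rewrite coef_poly -co; case: ltnP => // iX.
by rewrite coefL_gt //; lia.
Qed.

Lemma coef_polypart X (i : nat) : (polypart X)`_i = coefL X i%:Z.
Proof.
rewrite coef_poly; case: ltnP => // iX; rewrite coefL_gt //; lia.
Qed.

Lemma eqL_laurent_val X Y : eqL X Y -> laurent_val X = laurent_val Y.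
Proof.
move=> /funext E; set M := Num.max (lbound X) (lbound Y).
rewrite (@laurent_val_bound M) ?le_max ?lexx //.
by rewrite (@laurent_val_bound M) ?le_max ?lexx ?orbT // E.
Qed.

Lemma polypart_unique X q :
  degle (-1) (laurent_val X - pemb q) -> polypart X = q.
Proof.
move=> [a E]; apply: polypartE => i.
have {}E : laurent_val X = laurent_val (addL (polyL q) (Laurent (-1) a)).
  rewrite laurent_val_add laurent_val_poly addrC; apply/eqP.
  by rewrite -subr_eq E.
by rewrite (laurent_val_eqL E) coefL_add coefL_poly coefL_gt ?addr0.
Qed.

Lemma polypart_ex z : exists q, degle (-1) (z - pemb q).
Proof.
have [X <-] := laurent_val_surj z; exists (polypart X).
set Y := Laurent (-1) (fun j : nat => coefL X (-1 - j%:Z)).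
suff -> : laurent_val X - pemb (polypart X) = laurent_val Y by exists (lcoef Y).
apply/eqP; rewrite subr_eq addrC -laurent_val_poly -laurent_val_add.
apply/eqP/eqL_laurent_val => m; rewrite coefL_add coefL_poly.
case: m => i; first by rewrite coef_polypart [X in _ + X]coefL_gt ?addr0.
rewrite add0r [RHS]/coefL /=; congr (coefL X _); lia.
Qed.

(** A denominator of degree below [k] with an error of degree below [-k]: its existence prevents [k]
    from being the degree of a convergent denominator of [x]. *)
Definition approx x (k : nat) : Prop :=
  exists Q P : {poly F}, [/\ Q != 0, (size Q <= k)%N &
    degle (- k.+1%:Z) (pemb Q * x - pemb P)].

End LaurentField.

(** * The p-Cantor series is [1 / sqrt(t^2 + 1)] *)

Section CantorSeries.
Local Open Scope ring_scope.
Variable p : nat.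
Hypotheses (p_pr : prime p) (p_odd : odd p).
Local Notation F := 'F_p.
Local Notation c := (cantor p).

Lemma size_phi (w : seq F) : size (phi w) = (size w * p)%N.
Proof.
rewrite /phi size_flatten /shape -map_comp; elim: w => //= x w ->.
by rewrite size_mkseq mulSn.
Qed.

Lemma nth_phi (w : seq F) n i : (i < p)%N -> (n < size w)%N ->
  nth 0 (phi w) (n * p + i) = phi_letter (nth 0 w n) i.
Proof.
move=> ip; elim: w n => //= x w IH [|n] nw.
  by rewrite /phi /= nth_cat size_mkseq ip nth_mkseq.
rewrite /phi /= nth_cat size_mkseq ifF; last by lia.
by rewrite mulSn -addnA addKn; apply: IH.
Qed.

Lemma size_iter_phi j : size (iter j (@phi p) [:: 1]) = (p ^ j)%N.
Proof. by elim: j => //= j IH; rewrite size_phi IH expnSr. Qed.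

Lemma p2_double : p = (p2 p).*2.+1.
Proof. by rewrite /p2; have := odd_double_half p; rewrite p_odd; case: (p) => //= n; lia. Qed.

Lemma phi_letter0 (z : F) : phi_letter z 0 = z.
Proof. by rewrite /phi_letter /= bin0 mulr1. Qed.

Lemma nth_iter_phiS j i : (i < p ^ j)%N ->
  nth 0 (iter j.+1 (@phi p) [:: 1]) i = nth 0 (iter j (@phi p) [:: 1]) i.
Proof.
have p0 := prime_gt0 p_pr.
elim: j i => [|j IH] i ij.
  move: ij; rewrite expn0 ltnS leqn0 => /eqP ->.
  by rewrite /= -[0%N]/(0 * p + 0)%N nth_phi //= phi_letter0.
have ipj : (i %/ p < p ^ j)%N by rewrite ltn_divLR // -expnSr.
have ip : (i %% p < p)%N by rewrite ltn_mod.
rewrite (divn_eq i p) iterS [in RHS]iterS !nth_phi ?size_iter_phi ?IH //.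
by apply: leq_trans ipj _; rewrite leq_exp2l // prime_gt1.
Qed.

Lemma nth_iter_phi j j' i : (j <= j')%N -> (i < p ^ j)%N ->
  nth 0 (iter j' (@phi p) [:: 1]) i = nth 0 (iter j (@phi p) [:: 1]) i.
Proof.
move=> /subnK <-; elim: (j' - j)%N => // d IH ij.
rewrite addSn nth_iter_phiS ?IH //; apply: leq_trans ij _.
by rewrite leq_exp2l ?prime_gt1 // leq_addl.
Qed.

Lemma cantorE j i : (i < p ^ j)%N -> c i = nth 0 (iter j (@phi p) [:: 1]) i.
Proof.
move=> ij; have i1 : (i < p ^ i.+1)%N.
  by apply: ltn_trans (ltnSn i) _; exact: ltn_expl (prime_gt1 p_pr).
by case: (leqP j i.+1) => H; rewrite /cantor ?(nth_iter_phi H ij) ?(nth_iter_phi (ltnW H) i1).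
Qed.

Lemma cantor_digit n i : (i < p)%N -> c (n * p + i)%N = phi_letter (c n) i.
Proof.
move=> ip; have np : (n < p ^ n)%N by exact: ltn_expl (prime_gt1 p_pr).
rewrite (cantorE np) (@cantorE n.+1) ?iterS ?nth_phi ?size_iter_phi //.
rewrite expnSr; apply: leq_trans (_ : n * p + p <= _)%N; first by rewrite ltn_add2l.
by rewrite -mulSnr leq_mul2r np orbT.
Qed.

Lemma cantor0 : c 0%N = 1. Proof. by rewrite (@cantorE 0). Qed.

(** As [p] is odd, an odd [n] has either an odd last digit in base [p], where the letter is 0, or an
    odd quotient by [p], covered by induction. *)
Lemma cantor_odd n : odd n -> c n = 0.
Proof.
elim/ltn_ind: n => n IH on.
have ip : (n %% p < p)%N by rewrite ltn_mod prime_gt0.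
rewrite (divn_eq n p) cantor_digit // /phi_letter; case: ifP => // oi.
have o : odd (n %/ p).
  by move: on; rewrite {1}(divn_eq n p) oddD oddM p_odd oi andbT addbF.
rewrite IH ?mul0r // ltn_Pdiv ?prime_gt1 //; by case: (n) on.
Qed.

Definition cantor_fps : fps F := c.
Local Notation g := cantor_fps.

Lemma fps_exp_trunc N (a : fps F) j n : (n < N)%N ->
  (a ^+ j) n = ((fps_trunc N a) ^+ j)`_n.
Proof.
elim: j n => [|j IH] n nN; first by rewrite !expr0 coef1; case: n nN.
rewrite !exprS fps_mulE coefM; apply: eq_bigr => i _.
have iN : (i < N)%N by apply: leq_ltn_trans nN; rewrite -ltnS.
by rewrite IH ?coef_poly ?iN // (leq_ltn_trans (leq_subr _ _)).
Qed.

(** Frobenius is additive on the truncation, and the coefficients are unchanged because [z^p = z] in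
    [F_p]. *)
Lemma fps_expp (a : fps F) n : (a ^+ p) n = if (p %| n)%N then a (n %/ p)%N else 0.
Proof.
rewrite (@fps_exp_trunc n.+1) // /fps_trunc poly_def.
have chp : p \in [pchar {poly F}] by rewrite pchar_poly pchar_Fp.
rewrite -(pFrobenius_autE chp) rmorph_sum coef_sum /=.
have E (i : nat) : (pFrobenius_aut chp (a i *: 'X^i))`_n = if (n == i * p)%N then a i else 0.
  rewrite pFrobenius_autE exprZn -exprM coefZ coefXn.
  rewrite -[X in a i ^+ X](card_Fp p_pr) expf_card.
  by case: eqP; rewrite ?mulr1 ?mulr0.
under eq_bigr do rewrite E.
rewrite -big_mkcond /=; case: ifP => [/dvdnP[m nE]|pn]; last first.
  by rewrite big1 // => i /eqP nE; case/negP: (negbT pn); rewrite nE dvdn_mull.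
have p0 := prime_gt0 p_pr.
have mn : (m < n.+1)%N by rewrite nE ltnS leq_pmulr.
rewrite (big_pred1 (Ordinal mn)) => [|i]; first by rewrite /= nE mulnK.
rewrite /= -val_eqE /=; transitivity (m * p == i * p)%N; first by rewrite -nE.
by rewrite eqn_pmul2r // eq_sym.
Qed.

(** The word substituted for the letter 1 lists the coefficients of a binomial power. *)
Lemma coef_p2_power i : ((1 + fps_X F ^+ 2) ^+ p2 p) i =
  if (i < p)%N then phi_letter (1 : F) i else 0.
Proof.
rewrite exprDn fps_sumE.
have E (j : nat) : ((1 ^+ (p2 p - j) * (fps_X F ^+ 2) ^+ j) *+ 'C(p2 p, j)) i =
   if (j.*2 == i)%N then ('C(p2 p, j))%:R else 0.
  rewrite expr1n mul1r -exprM -[_ *+ _]mulr_natl.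
  have -> : ('C(p2 p, j)%:R : fps F) = fps_const ('C(p2 p, j)%:R) by rewrite rmorph_nat.
  rewrite fps_constM fps_Xn mul2n.
  by case: eqP; rewrite ?mulr1 ?mulr0.
under eq_bigr do rewrite E.
rewrite -big_mkcond /= /phi_letter mul1r.
case: ltnP => ip; last first.
  rewrite big1 // => j /eqP ji; have := ltn_ord j.
  by rewrite ltnS -leq_double ji; have := p2_double; lia.
case: ifP => oi.
  by rewrite big1 // => j /eqP ji; move: oi; rewrite -ji odd_double.
have i2 : (i./2 < (p2 p).+1)%N.
  by rewrite ltnS -leq_double even_halfK ?oi //; have := p2_double; lia.
rewrite (big_pred1 (Ordinal i2)) // => j; rewrite /= -val_eqE /=.
by rewrite -[in LHS](even_halfK (negbT oi)) (inj_eq double_inj).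
Qed.

(** [g^p] has only exponents divisible by [p] and the other factor only exponents below [p], so a
    single product contributes to index [n]; it is given by [cantor_digit]. *)
Lemma cantor_fps_frob : g = (1 + fps_X F ^+ 2) ^+ p2 p * g ^+ p.
Proof.
have p0 := prime_gt0 p_pr.
apply: funext => n; rewrite fps_mulE.
have ip : (n %% p < n.+1)%N by rewrite ltnS leq_mod.
rewrite (bigD1 (Ordinal ip)) //= big1 ?addr0 => [|j jn].
  rewrite coef_p2_power ltn_mod p0 fps_expp.
  have -> : (n - n %% p = n %/ p * p)%N by rewrite {1}(divn_eq n p) addnK.
  rewrite dvdn_mull // mulnK // /g {1}(divn_eq n p) cantor_digit ?ltn_mod //.
  by rewrite /phi_letter; case: ifP; rewrite ?mul0r // mul1r mulrC.
rewrite coef_p2_power; case: ifP => jp; last by rewrite mul0r.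
rewrite fps_expp; case: ifP => [|_]; last by rewrite mulr0.
have jln : (j <= n)%N by rewrite -ltnS.
rewrite -eqn_mod_dvd // => /eqP E; move: jn.
by rewrite -val_eqE /= E modn_small ?eqxx.
Qed.

(** Cancelling [g] in [cantor_fps_frob] gives [h^p2 = 1]. In the factorization of [h^p2 - 1] by
    [h - 1], the cofactor has constant term [p2], which is nonzero modulo [p]. *)
Lemma cantor_fps_sq : (1 + fps_X F ^+ 2) * g ^+ 2 = 1.
Proof.
set h := _ * _.
have gn0 : g != 0.
  apply/eqP => /(congr1 (fun a : fps F => a 0%N)) /eqP.
  by rewrite /cantor_fps cantor0 oner_eq0.
have h1 : h ^+ p2 p = 1.
  apply: (mulfI gn0); rewrite mulr1 [RHS]cantor_fps_frob /h exprMn -exprM mul2n.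
  by rewrite mulrCA -exprS -p2_double.
have h0 : h 0%N = 1.
  rewrite /h fps_mulE big_ord1 subnn fps_addE fps_Xn addr0 expr2 fps_mulE big_ord1 subnn.
  by rewrite /cantor_fps cantor0 !mulr1.
have : (h - 1) * \sum_(i < p2 p) h ^+ i = 0 by rewrite -subrX1 h1 subrr.
move/eqP; rewrite mulf_eq0 subr_eq0 => /orP[/eqP //|/eqP].
move=> /(congr1 (fun a : fps F => a 0%N)) /=; rewrite fps_sumE.
have hi i : (h ^+ i) 0%N = 1.
  elim: i => [|i IH]; first by rewrite expr0.
  by rewrite exprS fps_mulE big_ord1 subnn IH h0 mulr1.
under eq_bigr do rewrite hi.
rewrite sumr_const card_ord => /eqP.
rewrite -(dvdn_pcharf (pchar_Fp p_pr)) => /dvdn_leq.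
have := p2_double; have := prime_gt1 p_pr; lia.
Qed.

Local Notation K := {fraction (fps F)}.
Definition theta : K := laurent_val (Theta p).
Definition Dpoly : {poly F} := 'X^2 + 1.
Local Notation t := (tvar F).

Lemma thetaE : theta = t^-1 * tofrac g. Proof. by []. Qed.

Lemma theta_sq : theta ^+ 2 * pemb Dpoly = 1.
Proof.
rewrite thetaE rmorphD rmorph1 /= pembXn exprMn exprVn.
have t0 : t ^+ 2 != 0 by rewrite expf_neq0 ?tvar_neq0.
have E : t ^+ 2 + 1 = t ^+ 2 * tofrac (1 + fps_X F ^+ 2).
  rewrite tofracD tofrac1 tofracXn mulrDr mulr1; congr (_ + _).
  by rewrite -exprMn /tvar mulVf ?expr1n // tofrac_eq0 fps_X_neq0.
rewrite E -mulrA mulrCA mulKf // -tofracXn -tofracM mulrC cantor_fps_sq.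
by rewrite tofrac1.
Qed.

Lemma pchar_K : p \in [pchar K].
Proof.
have := rmorph_pchar (@tofrac (fps F) \o @fps_const F) (pchar_Fp p_pr); exact.
Qed.

(** An even power of [theta] cancels against [Dpoly] by [theta_sq]. This turns [q]-th powers of
    approximations into approximations of [theta] itself. *)
Lemma theta_frob s :
  theta = pemb (Dpoly ^+ ((p ^ s).-1./2)) * theta ^+ (p ^ s).
Proof.
have -> : (p ^ s = (p ^ s).-1./2.*2.+1)%N.
  have : odd (p ^ s) by rewrite oddX p_odd orbT.
  by move: (p ^ s)%N => q oq; rewrite even_halfK; case: q oq => //= q; lia.
rewrite /= doubleK; set m := ((p ^ s).-1./2)%N.
rewrite rmorphXn /= exprS mulrCA -mul2n exprM -exprMn (mulrC (pemb _)).
by rewrite theta_sq expr1n mulr1.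
Qed.

End CantorSeries.

(* Write [k = a q - r] or [k = a q + r] with [a] odd and [0 <= r <= q], and
   [m = 2 h q + u].  The [q]-th power of an approximation of [t^a theta] with
   denominator of degree at most [2h] rules out [r < u <= q], respectively
   [0 < u <= q - r]. *)
Definition zero_window (q k m : nat) : bool :=
  if (k %% q.*2 <= q)%N then (q - k %% q.*2 < m %% q.*2 <= q)%N
  else (0 < m %% q.*2 <= q.*2 - k %% q.*2)%N.

(** * Approximations of [t^k theta] on the windows *)

Section Windows.
Local Open Scope ring_scope.
Variable p : nat.
Hypotheses (p_pr : prime p) (p_odd : odd p).
Local Notation F := 'F_p.
Local Notation c := (cantor p).
Local Notation t := (tvar F).
Local Notation theta := (theta p).

Lemma theta_tail (j : nat) : exists P : {poly F},
  t ^+ j * theta = pemb P + t^-1 * tofrac ((fun n : nat => c (n + j)%N) : fps F).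
Proof.
elim: j => [|j [P IH]].
  exists 0; rewrite rmorph0 add0r expr0 mul1r thetaE; congr (_ * tofrac _).
  by apply: funext => n; rewrite addn0.
exists ('X * P + (c j)%:P); rewrite exprS -mulrA IH mulrDr mulVKf ?tvar_neq0 //.
set b : fps F := fun n : nat => c (n + j)%N.
have -> : pemb ('X * P + (c j)%:P) = t * pemb P + tofrac (fps_const (c j)).
  by rewrite rmorphD rmorphM /= pembX pembC.
have E : tofrac b = tofrac (fps_const (c j)) +
    t^-1 * tofrac ((fun n : nat => c (n + j.+1)%N) : fps F).
  rewrite /tvar invrK -tofracM -tofracD; congr tofrac.
  rewrite {1}(fps_decomp b); congr (_ + _ * _).
  by apply: funext => n; rewrite /b addSnnS.
rewrite E; exact: addrA.
Qed.

(* For odd [a] the expansion of [t^a theta] only has even powers of [t], so an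
   even [Q] of degree [2h] has [h + 1] coefficients and only [h] conditions. *)
Lemma approx_odd (a h : nat) : odd a -> exists Q P : {poly F},
  [/\ Q != 0, (size Q <= h.*2.+1)%N &
    degle (- h.*2.+2%:Z) (pemb Q * (t ^+ a * theta) - pemb P)].
Proof.
move=> oa; have [P_ PE] := choice theta_tail.
(* Entry [(i, l)] is the contribution of [X^(2 i)] in [Q] to the coefficient of [t^-(2 l + 2)]; a
   left kernel vector kills all these coefficients. *)
pose M : 'M[F]_(h.+1, h) := \matrix_(i, l) c (l.*2.+1 + (i.*2 + a))%N.
have : kermx M != 0.
  rewrite -mxrank_eq0 mxrank_ker subn_eq0 -ltnNge ltnS; exact: rank_leq_col.
case/rowV0Pn => v /sub_kermxP vM v0.
pose Q : {poly F} := \sum_(i < h.+1) v 0 i *: 'X^(i.*2).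
have coefQ (i : 'I_h.+1) : Q`_(i.*2) = v 0 i.
  rewrite coef_sum (bigD1 i) //= big1 ?addr0 => [|j /negbTE ji].
    by rewrite coefZ coefXn eqxx mulr1.
  by rewrite coefZ coefXn (inj_eq double_inj) eq_sym (inj_eq val_inj) ji mulr0.
pose b : fps F := \sum_(i < h.+1) fps_const (v 0 i) * ((fun n : nat => c (n + (i.*2 + a))%N) : fps F).
exists Q, (\sum_(i < h.+1) v 0 i *: P_ (i.*2 + a)%N); split.
- apply: contraNneq v0 => Q0; apply/eqP/rowP => i.
  by rewrite -coefQ Q0 coef0 mxE.
- apply: (leq_trans (size_sum _ _ _)); apply/bigmax_leqP => i _.
  apply: (leq_trans (size_scale_leq _ _)).
  by rewrite size_polyXn ltnS leq_double -ltnS.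
have -> : pemb Q * (t ^+ a * theta) - pemb (\sum_(i < h.+1) v 0 i *: P_ (i.*2 + a)%N)
    = t^-1 * tofrac b.
  rewrite !rmorph_sum mulr_suml -sumrB [RHS]mulr_sumr; apply: eq_bigr => i _ /=.
  rewrite -!mul_polyC !rmorphM /= pembXn pembC -mulrA.
  by rewrite [t ^+ _ * (_ * _)]mulrA -exprD PE mulrDr addrC addKr mulrCA.
have -> : b = fps_X F ^+ h.*2.+1 * ((fun n : nat => b (n + h.*2.+1)%N) : fps F).
  apply: fps_shift => n nh; rewrite /b fps_sumE.
  under eq_bigr do rewrite fps_constM.
  case on: (odd n); last first.
    rewrite big1 // => i _; rewrite cantor_odd ?mulr0 // !oddD on odd_double oa //.
  have lh : (n./2 < h)%N by lia.
  have := congr1 (fun w : 'rV_h => w 0 (Ordinal lh)) vM; rewrite !mxE => E.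
  rewrite -[RHS]E; apply: eq_bigr => i _; rewrite !mxE /=; congr (_ * c _).
  by rewrite -[in LHS](odd_double_half n) on.
rewrite tofracM -tvarN -exprN1 mulrA -tvarD.
apply: (@degle_le _ (-1 - h.*2.+1%:Z + 0)); first lia.
by apply: degleM; [exact: degle_t | exact: degle_fps].
Qed.

(** With [e = (q - 1) / 2], the [q]-th power of an approximation from [approx_odd], multiplied by
    [Dpoly^e], approximates [t^(a q) theta] with an error of degree at most [2 e - (2 h + 2) q]. *)
Lemma approx_window s k m : zero_window (p ^ s) k m ->
  approx (t ^+ k * theta) m.
Proof.
set q := (p ^ s)%N; rewrite /zero_window.
have q0 : (0 < q)%N by rewrite expn_gt0 prime_gt0.
have oq : odd q by rewrite oddX p_odd orbT.
set a := (k %/ q.*2).*2.+1; set h := (m %/ q.*2)%N.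
have oa : odd a by rewrite /= odd_double.
have [Q [P [Q0 sQ dQ]]] := approx_odd h oa.
set e := (q.-1./2)%N.
have qe : q = e.*2.+1 by rewrite /e even_halfK ?prednK // -subn1 oddB // oq.
have chq : [pchar {fraction (fps F)}].-nat q.
  rewrite pnatX pnatE ?prime_gt1 ?pchar_K //; apply: pchar_K.
have dw : degle (e.*2%:Z - h.*2.+2%:Z * q%:Z)
    (pemb (Q ^+ q) * (t ^+ (a * q) * theta) - pemb (Dpoly p ^+ e * P ^+ q)).
  have -> : pemb (Q ^+ q) * (t ^+ (a * q) * theta) - pemb (Dpoly p ^+ e * P ^+ q)
     = pemb (Dpoly p ^+ e) * (pemb Q * (t ^+ a * theta) - pemb P) ^+ q.
    rewrite [(_ - pemb P) ^+ q]exprDn_pchar // exprNn -signr_odd oq mulN1r.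
    rewrite {1}(theta_frob p_pr p_odd s) -/q -/e !exprMn -exprM.
    rewrite !rmorphM !rmorphXn /=.
    move: (pemb Q ^+ q) (theta ^+ q) (t ^+ (a * q)) (pemb _ ^+ e) (pemb P ^+ q).
    by move=> x1 x2 x3 x4 x5; ring.
  rewrite -mulNr; apply: degleM; last exact: degleX.
  rewrite rmorphXn /=.
  have -> : e.*2%:Z = 2%:Z * e%:Z by lia.
  apply: degleX; rewrite /Dpoly rmorphD rmorph1 /= pembXn.
  apply: degleD; first exact: (degle_t _ 2).
  by apply: (@degle_le _ 0) => //; exact: (degle_t _ 0).
have sQq : (size (Q ^+ q) <= (h.*2 * q).+1)%N.
  apply: leq_trans (size_exp_leq _ _) _; rewrite ltnS leq_mul2r; apply/orP; right.
  by rewrite -ltnS; apply: leq_trans (leqSpred _) _; case: (size Q) sQ.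
have Qq0 : Q ^+ q != 0 by rewrite expf_neq0.
have kE := divn_eq k q.*2; have mE := divn_eq m q.*2.
have kq : (k %% q.*2 < q.*2)%N by rewrite ltn_mod double_gt0.
rewrite -/h in mE; move: dw sQq kE mE kq; rewrite /a.
move: (k %/ q.*2)%N (k %% q.*2)%N (m %% q.*2)%N => u k' m' {a oa dQ} dw sQq kE mE kq.
(* For [k <= a q] the missing power of [t] goes into the denominator; otherwise the excess power
   goes into the numerator and the error. *)
case: ifP => kh /andP[m1 m2].
- have aq : (u.*2.+1 * q = k + (q - k'))%N by lia.
  exists ('X^(q - k') * Q ^+ q), (Dpoly p ^+ e * P ^+ q); split.
  + by rewrite mulf_neq0 // monic_neq0 ?monicXn.
  + apply: leq_trans (size_mul_leq _ _) _; rewrite size_polyXn.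
    by move: sQq; move: (size _) => N; lia.
  have -> : pemb ('X^(q - k') * Q ^+ q) * (t ^+ k * theta) =
      pemb (Q ^+ q) * (t ^+ (u.*2.+1 * q) * theta).
    by rewrite rmorphM /= pembXn aq exprD; ring.
  by apply: degle_le dw; lia.
have aq : (k = u.*2.+1 * q + (k' - q))%N by lia.
exists (Q ^+ q), ('X^(k' - q) * (Dpoly p ^+ e * P ^+ q)); split=> //.
  by move: sQq; move: (size _) => N; lia.
have -> : pemb (Q ^+ q) * (t ^+ k * theta) -
    pemb ('X^(k' - q) * (Dpoly p ^+ e * P ^+ q)) =
  t ^+ (k' - q) *
    (pemb (Q ^+ q) * (t ^+ (u.*2.+1 * q) * theta) - pemb (Dpoly p ^+ e * P ^+ q)).
  by rewrite [pemb ('X^_ * _)]rmorphM /= pembXn {1}aq exprD; ring.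
apply: (@degle_le _ ((k' - q)%N%:Z + (e.*2%:Z - h.*2.+2%:Z * q%:Z))); first lia.
by apply: degleM => //; exact: degle_t.
Qed.

End Windows.

(** * Continued fractions *)

Lemma is_period_le (T : Type) (A : nat -> T) N N' l :
  (N <= N')%N -> is_period A N l -> is_period A N' l.
Proof. by move=> NN [l0 H]; split=> // i Ni; apply: H; apply: leq_trans Ni. Qed.

Lemma period_length_ex (T : Type) (A : nat -> T) N l : is_period A N l ->
  exists N' l', period_length A l' /\ is_period A N' l'.
Proof.
move=> H; have ex : exists l, `[< exists N, is_period A N l >].
  by exists l; apply/asboolP; exists N.
case: (ex_minnP ex) => l' /asboolP[N' H'] min; exists N', l'; split=> //.
split; first by exists N'.
by move=> N1 l1 H1; apply: min; apply/asboolP; exists N1.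
Qed.

Lemma pigeonhole (T : finType) (f : nat -> T) : exists i j, (i < j)%N /\ f i = f j.
Proof.
have /injectivePn[i [j ij fij]] : ~~ injectiveb (fun i : 'I_#|T|.+1 => f i).
  apply/negP => /injectiveP /leq_card; by rewrite card_ord ltnn.
have : (i : nat) != j by rewrite (inj_eq val_inj).
by rewrite neq_ltn => /orP[]; [exists i, j | exists j, i].
Qed.

(** * Best approximation and the degrees of convergent denominators *)

Section Descent.
Local Open Scope ring_scope.
Variable F : fieldType.
Local Notation K := {fraction (fps F)}.
Variables (x : nat -> K) (A : nat -> {poly F}).
Hypothesis xA : forall n, degle (-1) (x n - pemb (A n)).
Hypothesis xS : forall n, (x n - pemb (A n)) * x n.+1 = 1.

Lemma degle_one (n : int) : degle n (1 : K) -> 0 <= n.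
Proof.
move=> H; apply: (@degle_top F n 0 1); first exact: oner_neq0.
by rewrite expr0z tofrac1 mulr1.
Qed.

(** With a constant [A n.+1], the product of [x n - A n] and [x n.+1] would have degree at most -1
    and could not be 1. *)
Lemma cf_deg_gt0 n : (0 < degP (A n.+1))%N.
Proof.
rewrite /degP -subn1 subn_gt0 ltnNge; apply/negP => sA.
suff /degle_one : degle (-1 + 0) (1 : K) by [].
rewrite -(xS n); apply: degleM => //; rewrite -[x n.+1](subrK (pemb (A n.+1))).
apply: degleD; first by apply: degle_le (xA _).
by apply: degle_le (degle_pemb _); move: sA; move: (size _) => N; lia.
Qed.

Lemma cf_neq0 n : A n.+1 != 0.
Proof. by have := cf_deg_gt0 n; apply: contraTneq => ->; rewrite /degP size_poly0. Qed.

(* If [Q x_i - P = e] is small then, with [Q' := P - A_i Q],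
   [Q' x_(i+1) - Q = - e x_(i+1)] is a good approximation of [x_(i+1)] with a
   smaller denominator. *)
Lemma cf_best_approx n i (Q P : {poly F}) :
  (size Q <= \sum_(j < n) degP (A (i + j).+1))%N ->
  degle (- (\sum_(j < n) degP (A (i + j).+1)).+1%:Z) (pemb Q * x i - pemb P) ->
  Q = 0.
Proof.
elim: n i Q P => [|n IH] i Q P.
  by rewrite big_ord0 leqn0 size_poly_eq0 => /eqP.
rewrite big_ord_recl addn0; set d := degP (A i.+1).
have -> : (\sum_(j < n) degP (A (i + lift ord0 j).+1) =
           \sum_(j < n) degP (A (i.+1 + j).+1))%N.
  by apply: eq_bigr => j _; rewrite /= /bump /= add1n addSnnS.
set V := (\sum_(j < n) _)%N; set e := pemb Q * x i - pemb P => sQ de.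
have yd : degle (- d%:Z) (x i - pemb (A i)).
  apply: (degle_inv (cf_neq0 i) (xA i.+1)); rewrite [pemb (A i.+1) + _]addrC subrK; exact: xS.
have xd : degle d%:Z (x i.+1).
  rewrite -[x i.+1](subrK (pemb (A i.+1))); apply: degleD.
    by apply: degle_le (xA _).
  by apply: degle_le (degle_pemb _); rewrite /d /degP; move: (size _) => N; lia.
have Q'E : pemb (P - A i * Q) = pemb Q * (x i - pemb (A i)) - e.
  by rewrite rmorphB rmorphM /= /e; ring.
have Q'0 : P - A i * Q = 0.
  apply: (IH i.+1 _ Q); rewrite -/V.
    apply: pemb_size; rewrite Q'E; apply: degleB; last by apply: degle_le de; lia.
    apply: degle_le (degleM (degle_pemb Q) yd).
    by move: sQ; move: (size Q) => N; lia.
  have -> : pemb (P - A i * Q) * x i.+1 - pemb Q = - (e * x i.+1).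
    by rewrite Q'E mulrBl -mulrA xS mulr1 addrC addKr.
  by apply: degleN; apply: degle_le (degleM de xd); lia.
have QE : pemb Q = e * x i.+1.
  have /eqP := Q'E; rewrite Q'0 rmorph0 eq_sym subr_eq0 => /eqP <-.
  by rewrite -mulrA xS mulr1.
apply: degle_neg_pemb; rewrite QE; apply: degle_le (degleM de xd); lia.
Qed.

(** The degree of the denominator of the [n]-th convergent, to which [A 0] does not contribute. *)
Definition cf_height n : nat := \sum_(1 <= j < n.+1) degP (A j).

Lemma cf_height_lt : {homo cf_height : i j / (i < j)%N}.
Proof.
apply: homo_ltn => [|i]; first exact: ltn_trans.
by rewrite /cf_height (big_nat_recr i.+1) //= -[X in (X < _)%N]addn0 ltn_add2l cf_deg_gt0.
Qed.

Lemma approx_height m n : approx (x 0%N) m -> cf_height n != m.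
Proof.
move=> [Q [P [Q0 sQ dQ]]]; apply: contraNneq Q0 => H; apply/eqP.
have E : (\sum_(j < n) degP (A (0 + j).+1) = m)%N.
  rewrite -H /cf_height big_add1 /= big_mkord; exact: eq_bigr.
by apply: (@cf_best_approx n 0 Q P); rewrite E.
Qed.

End Descent.

(** * Periodic expansions of quadratic irrationals over a finite field *)

Section QuadraticCF.
Local Open Scope ring_scope.
Variable F : finFieldType.
Local Notation K := {fraction (fps F)}.
Variables (Delta Q0 sigma : {poly F}) (s : K).
Hypothesis sE : s ^+ 2 = pemb Delta.
Hypothesis sigmaP : degle (-1) (s - pemb sigma).
Hypothesis Delta_nsq : forall P : {poly F}, P ^+ 2 != Delta.
Hypothesis Q0_neq0 : Q0 != 0.
Hypothesis Q0_dvd : Q0 %| Delta.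

(** Since [s] and [sigma] differ by a series of degree at most -1, this division gives the
    polynomial part of [(P + s) / Q]. *)
Definition cf_digit (st : {poly F} * {poly F}) : {poly F} := (st.1 + sigma) %/ st.2.
(** The classical recurrence for complete quotients [(P + s) / Q]; the division is exact as long as
    [Q] divides [Delta - P^2]. *)
Definition cf_step (st : {poly F} * {poly F}) : {poly F} * {poly F} :=
  let P' := cf_digit st * st.2 - st.1 in (P', (Delta - P' ^+ 2) %/ st.2).
Definition cf_quot (st : {poly F} * {poly F}) : K := (pemb st.1 + s) / pemb st.2.
Definition cf_state n := iter n cf_step (0, Q0).

(** Modulo [Q], [P'] is [-P], so divisibility persists. [Q'] is nonzero because [Delta] is not a
    square, and the last identity is [(s - P') (s + P') = Q Q']. *)
Lemma cf_stepP st : st.2 != 0 -> st.2 %| Delta - st.1 ^+ 2 ->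
  [/\ (cf_step st).2 * st.2 = Delta - (cf_step st).1 ^+ 2, (cf_step st).2 != 0,
      degle (-1) (cf_quot st - pemb (cf_digit st)) &
      (cf_quot st - pemb (cf_digit st)) * cf_quot (cf_step st) = 1].
Proof.
case: st => P Q /= Qn0 QD; set A := cf_digit (P, Q); set P' := A * Q - P.
have dv : Q %| Delta - P' ^+ 2.
  have -> : Delta - P' ^+ 2 = (Delta - P ^+ 2) + (A * (P *+ 2 - A * Q)) * Q.
    by rewrite /P'; ring.
  by apply: dvdp_add => //; apply: dvdp_mull.
have E : (Delta - P' ^+ 2) %/ Q * Q = Delta - P' ^+ 2 by rewrite divpK.
have Q'0 : (Delta - P' ^+ 2) %/ Q != 0.
  by rewrite dvdp_div_eq0 // subr_eq0 eq_sym Delta_nsq.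
have eQ : pemb Q != 0 by rewrite pemb_eq0.
have y1 : cf_quot (P, Q) - pemb A = (s - pemb P') / pemb Q.
  rewrite /cf_quot /= /P' rmorphB rmorphM /= -{1}[pemb A](mulfK eQ) -mulrBl.
  by rewrite opprB addrA [s + _]addrC.
split=> //.
  have -> : cf_quot (P, Q) - pemb A =
      (pemb ((P + sigma) %% Q) + (s - pemb sigma)) * (pemb Q)^-1.
    have := divp_eq (P + sigma) Q; rewrite -/A => /(congr1 (@pemb F)).
    rewrite y1 /P' /A /cf_digit /= !rmorphB !rmorphD !rmorphM /= => PE; congr (_ * _).
    by rewrite opprB -[pemb P](addrK (pemb sigma)) PE; ring.
  have sz : (0 < size Q)%N by rewrite size_poly_gt0.
  have dm : degle ((size Q)%:Z - 2) (pemb ((P + sigma) %% Q) + (s - pemb sigma)).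
    apply: degleD.
      apply: degle_le (degle_pemb _); have := ltn_modp (P + sigma) Q.
      rewrite Qn0; move: (size _) (size _) => N M; lia.
    by apply: degle_le sigmaP; move: sz; move: (size _) => N; lia.
  have dV : degle (- (size Q).-1%:Z) (pemb Q)^-1.
    apply: (degle_inv Qn0 (degle0 _ (-1))); by rewrite addr0 mulVf.
  apply: degle_le (degleM dm dV); move: sz; move: (size _) => N; lia.
have eQ' : pemb ((Delta - P' ^+ 2) %/ Q) != 0 by rewrite pemb_eq0.
rewrite y1 /cf_quot /cf_step /= -/A -/P' mulf_div.
have QQ' : pemb Q * pemb ((Delta - P' ^+ 2) %/ Q) = s ^+ 2 - pemb P' ^+ 2.
  by rewrite mulrC -rmorphM E rmorphB rmorphXn sE.
have -> : (s - pemb P') * (pemb P' + s) = pemb Q * pemb ((Delta - P' ^+ 2) %/ Q).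
  by rewrite QQ' subr_sqr [pemb P' + s]addrC.
exact: divff (mulf_neq0 eQ eQ').
Qed.

Lemma cf_state_inv n :
  (cf_state n).2 != 0 /\ (cf_state n).2 %| Delta - (cf_state n).1 ^+ 2.
Proof.
elim: n => [|n [H1 H2]]; first by rewrite /= expr0n subr0.
rewrite -[cf_state n.+1]/(cf_step (cf_state n)).
have [<- H _ _] := cf_stepP H1 H2; split=> //; exact/dvdp_mulr/dvdpp.
Qed.

Lemma cf_quotB n : degle (-1) (cf_quot (cf_state n) - pemb (cf_digit (cf_state n))).
Proof. by have [H1 H2] := cf_state_inv n; have [] := cf_stepP H1 H2. Qed.

Lemma cf_quotS n :
  (cf_quot (cf_state n) - pemb (cf_digit (cf_state n))) * cf_quot (cf_state n.+1) = 1.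
Proof. by have [H1 H2] := cf_state_inv n; have [] := cf_stepP H1 H2. Qed.

(** [P'] is [sigma] minus a remainder modulo [Q], and [Q'] is [P' + s] times a series of degree at
    most -1, so a common bound on the sizes persists. *)
Lemma cf_state_bound : exists B : nat, forall n,
  (size (cf_state n).1 <= B)%N /\ (size (cf_state n).2 <= B)%N.
Proof.
have sd : degle ((size sigma)%:Z) s.
  rewrite -[s](subrK (pemb sigma)); apply: degleD.
    by apply: degle_le sigmaP; move: (size _) => N; lia.
  by apply: degle_le (degle_pemb _); move: (size _) => N; lia.
exists (maxn (size sigma).+1 (size Q0)) => n; set B := maxn _ _.
have sB : (size sigma < B)%N by rewrite leq_max leqnn.
elim: n => [|n [IH1 IH2]]; first by split=> /=; rewrite ?size_poly0 // leq_maxr.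
have [H1 H2] := cf_state_inv n; have [_ Qn0 dy yx] := cf_stepP H1 H2.
rewrite -[cf_state n.+1]/(cf_step (cf_state n)); set st := cf_state n in H1 H2 Qn0 dy yx IH1 IH2 *.
have P'B : (size (cf_step st).1 <= B)%N.
  rewrite /cf_step /cf_digit /=.
  have -> : (st.1 + sigma) %/ st.2 * st.2 - st.1 = sigma - (st.1 + sigma) %% st.2.
    have := divp_eq (st.1 + sigma) st.2.
    move: (_ %/ _) (_ %% _) => A R PE; rewrite -[sigma](addKr st.1) PE; ring.
  apply: leq_trans (size_polyD _ _) _; rewrite size_polyN geq_max (ltnW sB) /=.
  by apply: leq_trans IH2; apply: ltnW; rewrite ltn_modp.
split=> //; apply: pemb_size.
have -> : pemb (cf_step st).2 =
    (cf_quot st - pemb (cf_digit st)) * (pemb (cf_step st).1 + s).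
  have Q'0 : pemb (cf_step st).2 != 0 by rewrite pemb_eq0.
  by apply: (divIf Q'0); rewrite divff // -mulrA; exact: esym yx.
apply: (@degle_le _ (-1 + B%:Z)); first lia.
apply: degleM => //; apply: degleD.
  by apply: degle_le (degle_pemb _); move: P'B; move: (size _) => N; lia.
by apply: degle_le sd; move: sB; move: (size _) => N; lia.
Qed.

(** Bounded states are pairs of row vectors over a finite field, and a repeated state repeats
    everything after it. *)
Lemma cf_digit_periodic : exists N l, is_period (fun n => cf_digit (cf_state n)) N l.
Proof.
have [B HB] := cf_state_bound.
have [i [j [ij /= E]]] := pigeonhole (fun n =>
  (poly_rV (cf_state n).1 : 'rV_B, poly_rV (cf_state n).2 : 'rV_B)).
have {}E : cf_state i = cf_state j.
  have [[i1 i2] [j1 j2]] := (HB i, HB j); case: E => E1 E2.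
  have := congr1 rVpoly E1; have := congr1 rVpoly E2; rewrite !poly_rV_K //.
  by case: (cf_state i) (cf_state j) => [P Q] [P' Q'] /= -> ->.
exists i, (j - i)%N; split; first by rewrite subn_gt0.
move=> n /subnK <-; congr cf_digit; rewrite -addnA subnKC ?(ltnW ij) //.
by rewrite /cf_state !iterD -!/(cf_state _) E.
Qed.

Lemma cf_expansion_digit (X : laurent F) : laurent_val X = s / pemb Q0 ->
  cf_expansion X (fun n => cf_digit (cf_state n)).
Proof.
move=> XE; have [xs xsE] := choice (@laurent_val_surj F).
exists (fun n => xs (cf_quot (cf_state n))); split.
  by apply: laurent_val_eqL; rewrite xsE XE /cf_quot /= rmorph0 add0r.
move=> n; split; first by apply/esym/polypart_unique; rewrite xsE; exact: cf_quotB.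
apply: laurent_val_eqL; rewrite laurent_val_mul laurent_val_add laurent_val_opp.
by rewrite laurent_val_poly !xsE cf_quotS laurent_val_one.
Qed.

End QuadraticCF.

(** * Counting *)

Lemma zero_window_add q u a b k m :
  zero_window q (a * (u * q.*2) + k) (b * (u * q.*2) + m) = zero_window q k m.
Proof. by rewrite /zero_window !mulnA !modnMDl. Qed.

(* The shift [i] is chosen so that [k] lands in [[q - M, q + M)]. *)
Lemma zero_window_lift p M k m : odd p -> (1 < p)%N -> (0 < M)%N ->
  (k < M.*2)%N -> (m < M.*2)%N ->
  exists i j : 'I_p, zero_window (p * M) (i * M.*2 + k) (j * M.*2 + m).
Proof.
move=> op p1 M0 kM mM.
have pE : p = (p./2).*2.+1 by rewrite -[LHS]odd_double_half op.
have h1 : (0 < p./2)%N by case: (p./2) pE p1 => // ->.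
have hp : (p./2 < p)%N by rewrite {2}pE; lia.
pose i := Ordinal hp; pose j0 := Ordinal (ltnW p1); pose j1 := Ordinal p1.
have qE : (p * M = p./2 * M.*2 + M)%N by rewrite {1}pE -!muln2; ring.
have q3 : (M.*2 + M <= p * M)%N.
  by rewrite qE leq_add2r leq_pmull.
have kq : ((p./2 * M.*2 + k) %% (p * M).*2 = p./2 * M.*2 + k)%N.
  by rewrite modn_small // qE; lia.
have jq0 : ((0 * M.*2 + m) %% (p * M).*2 = m)%N by rewrite modn_small //; lia.
have jq1 : ((1 * M.*2 + m) %% (p * M).*2 = M.*2 + m)%N.
  by rewrite mul1n modn_small //; lia.
exists i; rewrite /zero_window /= kq; case: leqP => H.
- have [mle|mgt] := leqP m M.
    by exists j1; rewrite /= jq1; lia.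
  by exists j0; rewrite /= jq0; lia.
- have [->|m0] := posnP m.
    by exists j1; rewrite /= mul1n addn0 modn_small; lia.
  by exists j0; rewrite /= jq0; lia.
Qed.

Lemma sum_nat_block n w (f : nat -> nat) :
  \sum_(0 <= k < n * w) f k = \sum_(i < n) \sum_(0 <= k < w) f (i * w + k).
Proof.
elim: n => [|n IH]; first by rewrite big_ord0 mul0n big_geq.
rewrite big_ord_recr /= -IH mulSnr (@big_cat_nat _ _ _ (n * w)) ?leq_addr //=.
congr (_ + _); rewrite -{1}[(n * w)%N]add0n big_addn addKn.
by apply: eq_bigr => k _; rewrite addnC.
Qed.

Lemma sum_nat_periodic w (f : nat -> nat) a n :
  (forall k, f (w + k) = f k) ->
  \sum_(a <= k < a + n * w) f k = n * \sum_(0 <= k < w) f k.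
Proof.
move=> fw; have fn i k : f (i * w + k) = f k.
  by elim: i => // i IH; rewrite mulSn -addnA fw.
elim: a => [|a IH].
  rewrite add0n sum_nat_block.
  transitivity (\sum_(i < n) \sum_(0 <= k < w) f k); last first.
    by rewrite sum_nat_const card_ord.
  by apply: eq_bigr => i _; apply: eq_bigr => k _; exact: fn.
case: (posnP (n * w)) => [nw|nw].
  by rewrite nw addn0 big_geq // -IH nw addn0 big_geq.
apply/eqP; rewrite -(eqn_add2l (f a)) -IH addSn.
rewrite -big_ltn ?ltnS ?leq_addr // big_nat_recr ?leq_addr //= addnC.
by rewrite [(a + _)%N]addnC fn.
Qed.

(** The points [h i] are distinct in [[h 0, h n)]. With [f] an indicator this bounds the number of
    heights by the number of admissible degrees. *)
Lemma sum_increasing (h : nat -> nat) (f : nat -> nat) n :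
  {homo h : i j / (i < j)%N} ->
  \sum_(0 <= i < n) f (h i) <= \sum_(h 0 <= m < h n) f m.
Proof.
move=> hh; elim: n => [|n IH]; first by rewrite !big_geq.
have h0 : (h 0 <= h n)%N.
  by case: n {IH} => // n; exact: ltnW (hh _ _ (ltn0Sn _)).
have hS : (h n < h n.+1)%N by exact: hh.
rewrite big_nat_recr // [X in (_ <= X)%N](@big_cat_nat _ _ _ (h n)) ?(ltnW hS) //=.
by apply: leq_add => //; rewrite big_ltn // leq_addr.
Qed.

Section Counting.
Variable p : nat.
Hypotheses (p1 : (1 < p)%N) (p_odd : odd p).

Definition modulus S : nat := (p ^ S).*2.
(** The pair avoids the windows of scales [p, ..., p^S], for which [modulus S] is a common period in
    both variables. *)
Definition survivor S k m : bool :=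
  all (fun s => ~~ zero_window (p ^ s.+1) k m) (iota 0 S).

Lemma modulus_gt0 S : (0 < modulus S)%N.
Proof. by rewrite double_gt0 expn_gt0 ltnW. Qed.

Lemma survivor_add S a b k m :
  survivor S (a * modulus S + k) (b * modulus S + m) = survivor S k m.
Proof.
apply: eq_in_all => s; rewrite mem_iota add0n /= => sS; congr (~~ _).
have -> : modulus S = (p ^ (S - s.+1) * (p ^ s.+1).*2)%N.
  by rewrite -doubleMr -expnD subnK.
exact: zero_window_add.
Qed.

Lemma survivorS S k m :
  survivor S.+1 k m = survivor S k m && ~~ zero_window (p ^ S.+1) k m.
Proof. by rewrite /survivor -addn1 iotaD all_cat /= andbT addn1. Qed.

Definition row_count S k : nat := \sum_(0 <= m < modulus S) survivor S k m.

Lemma row_count_add S k : row_count S (modulus S + k) = row_count S k.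
Proof.
apply: eq_bigr => m _.
by rewrite -(survivor_add S 1 0 k m) mul1n mul0n.
Qed.

(** A class of pairs modulo [modulus S] splits into [p^2] classes modulo [modulus S.+1], at least
    one of them inside a window by [zero_window_lift]. For [S = 0] there are 4 pairs. *)
Lemma survivor_total S :
  \sum_(0 <= k < modulus S) row_count S k <= 4 * (p ^ 2 - 1) ^ S.
Proof.
elim: S => [|S IH].
  by rewrite /row_count /survivor /modulus !expn0 /= !sum_nat_const_nat.
set M := modulus S.
have MS : modulus S.+1 = (p * M)%N by rewrite /M /modulus expnS doubleMr.
have -> : \sum_(0 <= k < modulus S.+1) row_count S.+1 k =
   \sum_(0 <= k < M) \sum_(0 <= m < M) \sum_(ij : 'I_p * 'I_p)
      survivor S.+1 (ij.1 * M + k) (ij.2 * M + m).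
  rewrite /row_count MS sum_nat_block exchange_big /=; apply: eq_bigr => k _.
  under eq_bigr do rewrite sum_nat_block.
  under eq_bigr do rewrite exchange_big /=.
  rewrite exchange_big /=; apply: eq_bigr => m _.
  by rewrite pair_bigA.
rewrite expnSr mulnA; apply: leq_trans (leq_mul IH (leqnn _)).
rewrite big_distrl /= big_nat [X in (_ <= X)%N]big_nat.
apply: leq_sum => k /andP[_ kM].
rewrite /row_count big_distrl /= big_nat [X in (_ <= X)%N]big_nat.
apply: leq_sum => m /andP[_ mM].
under eq_bigr do rewrite survivorS survivor_add.
case: survivor => /=; last by rewrite big1.
have [|i [j zij]] := zero_window_lift p_odd p1 _ kM mM; first by rewrite expn_gt0 ltnW.
rewrite (bigD1 (i, j)) //= expnS zij add0n mul1n.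
apply: (@leq_trans (\sum_(ij : 'I_p * 'I_p | ij != (i, j)) 1)%N).
  by apply: leq_sum => ij _; case: zero_window.
by rewrite sum1_card cardC1 card_prod !card_ord -mulnn subn1.
Qed.

End Counting.

(** * The continued fraction of [t^k theta] *)

Section CantorCF.
Local Open Scope ring_scope.
Variable p : nat.
Hypotheses (p_pr : prime p) (p_odd : odd p).
Local Notation F := 'F_p.
Local Notation t := (tvar F).

(** Dividing by [X^(2 k)] leaves [R^2 = X^2 + 1]. Differentiating, with 2 invertible, gives
    [R R' = X], so [R] divides [X] and hence 1; a constant [R] contradicts the degree. *)
Lemma Dpoly_nsq k (P : {poly F}) : P ^+ 2 != 'X^(k.*2) * Dpoly p.
Proof.
apply/eqP => E; have [R PE] : exists R, P = R * 'X^k.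
  apply/dvdpP; rewrite -(@dvdp_pexp2r _ _ _ 2) // -exprM muln2 E.
  exact/dvdp_mulr/dvdpp.
have {E} RD : R ^+ 2 = Dpoly p.
  have X0 : ('X^(k.*2) : {poly F}) != 0 by rewrite monic_neq0 ?monicXn.
  by apply: (mulfI X0); rewrite -E PE exprMn -exprM muln2 mulrC.
have two0 : (2%:R : {poly F}) != 0.
  rewrite -polyC_natr polyC_eq0 -(dvdn_pcharf (pchar_Fp p_pr)).
  by rewrite dvdn_prime2 //; apply: contraTneq p_odd => ->.
have RX : R * R^`() = 'X.
  apply: (mulfI two0); rewrite mulr_natl mulr_natl.
  have := congr1 (@deriv F) RD; rewrite /Dpoly derivD derivXn expr1 -polyC1 derivC addr0 => <-.
  by rewrite expr2 derivM mulrC mulr2n [RHS]addrC.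
have R1 : R %| 1.
  have -> : 1 = R * R - 'X * 'X by rewrite -!expr2 RD /Dpoly addrC addKr.
  by apply: dvdp_sub; [apply/dvdp_mulr/dvdpp | rewrite -RX -mulrA; apply/dvdp_mulr/dvdpp].
have : size (R ^+ 2) = 3 by rewrite RD /Dpoly size_polyDl ?size_polyXn ?size_poly1.
have /size_poly1P[r _ ->] : size R == 1 by rewrite -dvdp1.
by rewrite -polyC_exp => H; have := size_polyC_leq1 (r ^+ 2); rewrite H.
Qed.

(** The last clause says that the number of partial quotients per unit of degree is at most the
    proportion of surviving [m] in row [k]. *)
Definition cantor_cf_spec k (A : nat -> {poly F}) N l :=
  [/\ cf_expansion (mulL (Theta p) (polyL 'X^k)) A, period_length A l,
      is_period A N l, (0 < \sum_(N <= i < N + l) degP (A i))%N &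
      forall S, (l * modulus p S <=
        (\sum_(N <= i < N + l) degP (A i)) * row_count p S k)%N].

Lemma cantor_cf k : exists A N l, cantor_cf_spec k A N l.
Proof.
set x := t ^+ k * theta p.
(* Now [x = s / Dpoly] with [s^2 = X^(2 k) Dpoly], so the expansion starts at the state
   [(0, Dpoly)]. *)
set s := x * pemb (Dpoly p).
have D0 : Dpoly p != 0.
  by rewrite -size_poly_gt0 /Dpoly size_polyDl ?size_polyXn ?size_poly1.
have sE : s ^+ 2 = pemb ('X^(k.*2) * Dpoly p).
  have sq (R : comNzRingType) (a th d : R) :
      th ^+ 2 * d = 1 -> (a * th * d) ^+ 2 = a ^+ 2 * d.
    by move=> E; rewrite -[d in RHS]mul1r -E; ring.
  by rewrite rmorphM /= pembXn -muln2 exprM; apply/sq/theta_sq.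
have [sigma sigmaP] := polypart_ex s.
have dv : Dpoly p %| 'X^(k.*2) * Dpoly p by apply/dvdp_mull/dvdpp.
have nsq := Dpoly_nsq k.
pose A n := cf_digit sigma (cf_state ('X^(k.*2) * Dpoly p) (Dpoly p) sigma n).
pose q n := cf_quot s (cf_state ('X^(k.*2) * Dpoly p) (Dpoly p) sigma n).
have qA n : degle (-1) (q n - pemb (A n)) by exact: cf_quotB.
have qS n : (q n - pemb (A n)) * q n.+1 = 1 by exact: cf_quotS.
have q0 : q 0%N = x.
  by rewrite /q /cf_quot /= rmorph0 add0r /s mulfK // pemb_eq0.
have expA : cf_expansion (mulL (Theta p) (polyL 'X^k)) A.
  apply: (@cf_expansion_digit _ _ _ _ s) => //.
  rewrite laurent_val_mul laurent_val_poly pembXn mulrC.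
  by rewrite /s mulfK // pemb_eq0.
have [N0 [l0 perA0]] := cf_digit_periodic sE sigmaP nsq D0 dv.
(* The period is made to start at index 1 or later, since [A 0] may have degree 0. *)
have [N1 [l [plA /(is_period_le (leq_maxl N1 1%N)) perA]]] := period_length_ex perA0.
set N := maxn N1 1 in perA; have {}perA : is_period A N l by [].
have N_gt0 : (0 < N)%N by rewrite leq_max orbT.
exists A, N, l; set W := (\sum_(N <= i < N + l) degP (A i))%N.
pose f i := degP (A (N + i)%N).
have l_gt0 := perA.1.
have fl i : f (l + i)%N = f i.
  rewrite /f; have -> : (N + (l + i) = N + i + l)%N by lia.
  by rewrite perA.2 // leq_addr.
have fW j : (\sum_(0 <= i < j * l) f i = j * W)%N.
  rewrite -[(j * l)%N]add0n sum_nat_periodic // /W -{1}[N]add0n big_addn addKn.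
  by congr (_ * _)%N; apply: eq_bigr => i _; rewrite addnC.
have f_gt0 i : (0 < f i)%N.
  by rewrite /f -(prednK N_gt0) addSn; exact: (cf_deg_gt0 qA qS).
(* [h i] is the denominator degree just before the partial quotient [N + i], so its increments are
   the [f i]. *)
pose h i := cf_height A (N.-1 + i)%N.
have hE i : h i = (h 0 + \sum_(0 <= j < i) f j)%N.
  rewrite /h addn0 /cf_height -addSn prednK // (@big_cat_nat _ _ _ N) ?leq_addr //=.
  congr (_ + _)%N; rewrite -{1}[N]add0n big_addn addKn.
  by apply: eq_bigr => j _; rewrite /f addnC.
have hS : {homo h : i j / (i < j)%N}.
  by move=> i j ij; apply: (cf_height_lt qA qS); rewrite ltn_add2l.
split=> // [|S].
  rewrite -/W -[W]mul1n -fW mul1n; case: (l) l_gt0 => // l' _.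
  by rewrite big_nat_recl // addn_gt0 f_gt0.
rewrite -/W; have surv i : survivor p S k (h i).
  apply/allP => r _; apply/negP => /(approx_window p_pr p_odd).
  rewrite -/x -q0 => H.
  by have /eqP := @approx_height _ _ _ qA qS _ (N.-1 + i) H.
(* Over [modulus p S] periods of the expansion, the [l * modulus p S] heights are survivors in an
   interval made of exactly [W] periods of [survivor]. *)
rewrite -(@sum_nat_periodic _ (fun m => survivor p S k m : nat) (h 0)); last first.
  by move=> m; rewrite -(survivor_add p S 0 1 k m) mul1n mul0n.
have -> : (h 0 + W * modulus p S = h (l * modulus p S))%N.
  by rewrite [RHS]hE [(l * _)%N]mulnC fW mulnC.
apply: leq_trans (sum_increasing _ _ hS).
by under eq_bigr do rewrite surv; rewrite sum_nat_const_nat subn0 muln1.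
Qed.

End CantorCF.

(** * Densities and real estimates *)

Section Density.
Local Open Scope R_scope.

Lemma INR_leq m n : (m <= n)%N -> INR m <= INR n.
Proof. by move=> /ssrnat.leP; exact: le_INR. Qed.

Lemma INR_addn m n : INR (m + n)%N = INR m + INR n.
Proof. by rewrite -plusE plus_INR. Qed.

Lemma INR_muln m n : INR (m * n)%N = INR m * INR n.
Proof. by rewrite -multE mult_INR. Qed.

Lemma INR_expn m n : INR (m ^ n)%N = INR m ^ n.
Proof. by elim: n => // n IH; rewrite expnS INR_muln IH. Qed.

Lemma INR_gt0 n : (0 < n)%N -> 0 < INR n.
Proof. by move=> /ssrnat.ltP; exact: lt_0_INR. Qed.

Lemma count_upto_le P m : (count_upto P m <= m)%N.
Proof.
have {2}-> : (m = \sum_(1 <= k < m.+1) 1)%N by rewrite sum_nat_const_nat subn1 muln1.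
by apply: leq_sum => i _; case: excluded_middle_informative.
Qed.

(** Up to [m] there are at most [(m / w + 1) * beta] bad indices; for [m > w] the extra period at
    most doubles the main term. *)
Lemma density_one (P : nat -> Prop) :
  (forall delta, 0 < delta -> exists w (bad : nat -> bool),
    [/\ (0 < w)%N, forall k, bad (w + k)%N = bad k, forall k, ~~ bad k -> P k &
        INR (\sum_(0 <= k < w) bad k) <= delta * INR w]) ->
  has_density P (INR 1).
Proof.
move=> H eps eps0; have [|w [bad [w0 bw bP bd]]] := H (eps / 4); first by lra.
exists w.+1 => m /ssrnat.leP wm; set beta := (\sum_(0 <= k < w) bad k)%N in bd.
have c1 : (m <= count_upto P m + (m %/ w + 1) * beta)%N.
  rewrite -(sum_nat_periodic 1 (m %/ w + 1) (f := fun k => bad k : nat)); last first.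
    by move=> k; rewrite bw.
  apply: (@leq_trans (count_upto P m + \sum_(1 <= k < m.+1) bad k)); last first.
    rewrite leq_add2l [X in (_ <= X)%N](@big_cat_nat _ _ _ m.+1) ?leq_addr //=.
    rewrite add1n ltnS {1}(divn_eq m w) mulnDl mul1n leq_add2l ltnW //.
    by rewrite ltn_mod.
  have {1}-> : (m = \sum_(1 <= k < m.+1) 1)%N by rewrite sum_nat_const_nat subn1 muln1.
  rewrite /count_upto -big_split /=.
  apply: leq_sum => i _; case: excluded_middle_informative => //= nP.
  by case E: (bad i) => //; case: nP; apply: bP; rewrite E.
have c2 := INR_leq (count_upto_le P m); have {}c1 := INR_leq c1.
rewrite INR_addn INR_muln INR_addn in c1.
have mw : INR (m %/ w) * INR w <= INR m by rewrite -INR_muln; apply/INR_leq/leq_trunc_div.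
have w0' := INR_gt0 w0; have wm' := INR_leq (ltnW wm).
have m0 : 0 < INR m by lra.
have b0 : INR (m %/ w) * INR beta <= INR (m %/ w) * (eps / 4 * INR w).
  by apply: Rmult_le_compat_l => //; exact: pos_INR.
have c3 : INR m - eps / 2 * INR m <= INR (count_upto P m).
  move: c1 b0 mw; rewrite [INR 1]/=; nra.
rewrite /Rdist; have -> : INR (count_upto P m) / INR m - INR 1 =
    (INR (count_upto P m) - INR m) / INR m.
  by rewrite /Rdiv Rmult_minus_distr_r Rinv_r //; lra.
rewrite Rabs_left1; last first.
  by have := Rinv_0_lt_compat _ m0; rewrite /Rdiv; nra.
apply: (Rmult_lt_reg_r (INR m)) => //; rewrite -Ropp_mult_distr_l.
by rewrite /Rdiv Rmult_assoc Rinv_l; [nra | lra].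
Qed.

(** Truncation loses at most [n] per partial quotient, hence [l n] in all, and the hypotheses make
    this less than [eps] times the total degree. *)
Lemma escape_ratio_gt (F : fieldType) (A : nat -> {poly F}) N l n w c (eps : R) :
  (0 < \sum_(N <= i < N + l) degP (A i))%N -> (0 < w)%N ->
  (l * w <= (\sum_(N <= i < N + l) degP (A i)) * c)%N ->
  INR (n * c) < eps * INR w -> escape_ratio A N l n > 1 - eps.
Proof.
rewrite /escape_ratio; set W := (\sum_(_ <= i < _) degP _)%N.
set E := (\sum_(_ <= i < _) _)%N => W0 w0 lw nc.
have WE : (W <= E + l * n)%N.
  have -> : (l * n = \sum_(N <= i < N + l) n)%N by rewrite sum_nat_const_nat addKn.
  rewrite /E -big_split /=; apply: leq_sum => i _; lia.
have {}W0 := INR_gt0 W0; have {}w0 := INR_gt0 w0.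
have {}WE := INR_leq WE; have {}lw := INR_leq lw.
rewrite INR_addn INR_muln in WE; rewrite !INR_muln in lw; rewrite INR_muln in nc.
have n0 := pos_INR n.
have ln : INR l * INR n < eps * INR W.
  apply: (Rmult_lt_reg_r (INR w)) => //.
  apply: (@Rle_lt_trans _ (INR W * (INR n * INR c))).
    have := Rmult_le_compat_l _ _ _ n0 lw; lra.
  have := Rmult_lt_compat_l _ _ _ W0 nc; lra.
apply: (Rmult_lt_reg_r (INR W)) => //.
rewrite /Rdiv Rmult_assoc Rinv_l; lra.
Qed.

Lemma geometric_small (q : nat) (C delta : R) : (0 < q)%N -> 0 < delta ->
  exists S, C * INR ((q - 1) ^ S) <= delta * INR (q ^ S).
Proof.
move=> q0 d0; have {}q0' := INR_gt0 q0; set x := INR (q - 1) / INR q.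
have xq : INR (q - 1) = x * INR q by rewrite /x /Rdiv Rmult_assoc Rinv_l; lra.
have q1 : INR (q - 1) = INR q - 1 by rewrite -{2}(subnK q0) INR_addn /=; lra.
have x0 : 0 <= x.
  by apply: Rmult_le_pos; [exact: pos_INR | apply/Rlt_le/Rinv_0_lt_compat].
have x1 : Rabs x < 1.
  rewrite Rabs_pos_eq //; apply: (Rmult_lt_reg_r (INR q)) => //; lra.
have e0 : delta / (1 + Rabs C) > 0.
  by apply: Rdiv_lt_0_compat => //; have := Rabs_pos C; lra.
have [S HS] := pow_lt_1_zero _ x1 _ e0; exists S.
have := HS S (Nat.le_refl S); rewrite Rabs_pos_eq; last exact: pow_le.
move=> xS; rewrite !INR_expn xq Rpow_mult_distr -Rmult_assoc.
apply: Rmult_le_compat_r; first by apply: pow_le; lra.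
have C1 : C <= 1 + Rabs C by have := Rle_abs C; lra.
have C0 : 0 < 1 + Rabs C by have := Rabs_pos C; lra.
have xS0 : 0 <= x ^ S by exact: pow_le.
apply: (@Rle_trans _ ((1 + Rabs C) * x ^ S)); first exact: Rmult_le_compat_r.
apply: (@Rle_trans _ ((1 + Rabs C) * (delta / (1 + Rabs C)))).
  by apply: Rmult_le_compat_l; lra.
by rewrite /Rdiv (Rmult_comm delta) -Rmult_assoc Rinv_r; lra.
Qed.

End Density.

Theorem theorem1p30 (p : nat) (pr : prime p) (podd : odd p) (eps : R) (heps : Rlt 0 eps) :
  exists dn : nat -> R,
    (forall n : nat,
       has_density
         (fun k => exists r : R,
            e_val (mulL (Theta p) (polyL ('X^k : {poly 'F_p}))) n r /\ Rgt r (Rminus 1 eps))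
         (dn n)) /\
    Un_cv dn (INR 1).
Proof.
exists (fun=> INR 1); split; last first.
  by move=> e e0; exists 0%N => m _; rewrite /Rdist Rminus_diag Rabs_R0.
move=> n; apply: density_one => delta d0.
have p1 := prime_gt1 pr.
have p2 : (0 < p ^ 2)%N by rewrite expn_gt0 ltnW.
have de : Rlt 0 (Rmult delta eps) by exact: Rmult_lt_0_compat.
(* [S] is chosen so that [n] times the survivor bound is at most [delta * eps] times the number of
   pairs in a period. *)
have [S HS] := geometric_small (INR n) p2 de.
pose w := modulus p S.
(* The rows with too many survivors for [escape_ratio_gt]. *)
pose bad k := ~~ `[< Rlt (INR (n * row_count p S k)) (Rmult eps (INR w)) >].
exists w, bad; split.
- exact: modulus_gt0.
- by move=> k; rewrite /bad row_count_add.
- move=> k; rewrite negbK => /asboolP good.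
  have [A [N [l [expA plA perA W0 HA]]]] := cantor_cf pr podd k.
  exists (escape_ratio A N l n); split; first by exists A, N, l.
  exact: (escape_ratio_gt W0 (modulus_gt0 p1 S) (HA S) good).
have w0 : Rlt 0 (INR w) by apply/INR_gt0/modulus_gt0.
have ew : Rlt 0 (Rmult eps (INR w)) by exact: Rmult_lt_0_compat.
set beta := (\sum_(0 <= k < w) bad k)%N.
(* Markov's inequality: each bad row contributes at least [eps * w] to [n] times the number of
   survivors. *)
have b1 : Rle (Rmult (INR beta) (Rmult eps (INR w)))
    (INR (n * \sum_(0 <= k < w) row_count p S k)).
  rewrite /beta; elim: (w in index_iota 0 w) => [|u IH].
    by rewrite !big_geq // muln0 Rmult_0_l; exact: Rle_refl.
  rewrite !big_nat_recr //= mulnDr !INR_addn Rmult_plus_distr_r.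
  apply: Rplus_le_compat => //; rewrite /bad.
  case: asboolP => /= H; first by rewrite Rmult_0_l; exact: pos_INR.
  by rewrite Rmult_1_l; exact: Rnot_lt_le.
have b2 := INR_leq (leq_mul (leqnn n) (survivor_total p1 podd S)).
(* The number of pairs in a period; its factor 4 matches the one in [survivor_total]. *)
have w2 : (4 * (p ^ 2) ^ S = w * w)%N.
  rewrite /w /modulus -expnM [(2 * S)%N]mulnC expnM.
  by move: (p ^ S)%N => u; rewrite -mulnn; lia.
have w2' := congr1 INR w2; rewrite !INR_muln in w2' b2.
apply: (Rmult_le_reg_r (Rmult eps (INR w))) => //.
have de_w2 := congr1 (Rmult (Rmult delta eps)) w2'.
have i4 : INR 4 = IZR 4 by rewrite /=; lra.
move: b1 b2 de_w2 HS; rewrite -/w !INR_muln i4; lra.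
Qed.
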